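(* Let $X$ be a space that admits a finite good cover. Then $$\mathrm{ct}(X)\ \ge\ 1+\mathrm{hdim}(X)+\tfrac12\,\mathrm{cat}(X)\,(\mathrm{cat}(X)-1).$$
   Context: An open cover $\mathcal U$ of a space $Y$ is a good cover if all elements of $\mathcal U$ and all their non-empty finite intersections are contractible. The strict covering type $\mathrm{sct}(Y)$ is the minimal cardinality of a good cover of $Y$, and the covering type of $X$ is $\mathrm{ct}(X):=\min\{\mathrm{sct}(Y)\mid Y\simeq X\}$. A subset $A\subseteq X$ is categorical if the inclusion $A\hookrightarrow X$ is homotopic to a constant map. The Lusternik–Schnirelmann category $\mathrm{cat}(X)$ is the minimal $n$ for which $X$ can be covered by $n$ open categorical subsets (so a contractible space has category $1$). The homotopy dimension is $\mathrm{hdim}(X):=\min\{\dim Y\mid Y\simeq X,\ Y \text{ a CW complex}\}$.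
   Formalization: X is additionally assumed connected (for three isolated points ct = 3, cat = 3, hdim = 0 and the inequality fails) and homotopy equivalent to some CW complex (otherwise hdim(X) is a minimum over the empty set). *)

(* Defs.v *)
From HB Require Import structures.
From mathcomp Require Import all_boot all_order all_algebra.
From mathcomp Require Import all_classical all_reals all_analysis.

Set Implicit Arguments.
Unset Strict Implicit.
Unset Printing Implicit Defensive.

Import Order.TTheory GRing.Theory Num.Theory.
Import numFieldNormedType.Exports.

Local Open Scope classical_set_scope.
Local Open Scope ring_scope.

Definition homotopic (R : realType) (X Y : topologicalType) (f g : X -> Y) :=
  exists H : X * R -> Y,
    [/\ {within [set: X] `*` `[0, 1], continuous H},
        forall x, H (x, 0) = f x & forall x, H (x, 1) = g x].

Definition homotopy_equiv (R : realType) (X Y : topologicalType) :=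
  exists (f : X -> Y) (g : Y -> X),
    [/\ continuous f, continuous g,
        homotopic R (g \o f) (@idfun X) & homotopic R (f \o g) (@idfun Y)].

(* The empty space is not contractible. *)
Definition contractible (R : realType) (X : topologicalType) :=
  exists x0 : X, homotopic R (@idfun X) (cst x0).

(* The coercion of [A : set X] to a type carries the subspace topology. *)
Definition contractible_set (R : realType) (X : topologicalType) (A : set X) :=
  contractible R A.

Definition categorical (R : realType) (X : topologicalType) (A : set X) :=
  exists x0 : X, homotopic R (set_val : A -> X) (cst x0).

Definition open_cover (X : topologicalType) (U : set (set X)) :=
  (forall A, U A -> open A) /\ \bigcup_(A in U) A = [set: X].

(* "Non-empty" qualifies the intersection itself; [V !=set0] only rules out the
   intersection of the empty family, which is the whole space. *)
Definition good_cover (R : realType) (X : topologicalType) (U : set (set X)) :=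
  [/\ open_cover U,
      forall A, U A -> contractible_set R A &
      forall V : set (set X), V `<=` U -> finite_set V -> V !=set0 ->
        \bigcap_(A in V) A !=set0 -> contractible_set R (\bigcap_(A in V) A)].

(* The numerical invariants take values in [\bar R]. The infima below range over
   sets of extended natural numbers (together with -oo in the case of [hdim]),
   so they are minima when the set is non-empty; the infimum of the empty set
   is +oo. *)

Definition sct (R : realType) (X : topologicalType) : \bar R :=
  ereal_inf [set n%:R%:E | n in
    [set n : nat | exists U : set (set X), good_cover R U /\ (U #= `I_n)%card]].

Definition ct (R : realType) (X : topologicalType) : \bar R :=
  ereal_inf [set c | exists Y : topologicalType,
                       homotopy_equiv R Y X /\ c = sct R Y].

Definition lscat (R : realType) (X : topologicalType) : \bar R :=
  ereal_inf [set n%:R%:E | n in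
    [set n : nat | exists U : set (set X),
       [/\ open_cover U, forall A, U A -> categorical R A & (U #= `I_n)%card]]].

(* The library norm on ['rV[R]_n] is the sup norm, hence the explicit sums of
   squares. For n = 0 the open and the closed disk are both the single point of
   ['rV[R]_0], and the sphere is empty. *)
Definition disk (R : realType) (n : nat) : set 'rV[R]_n :=
  [set v | \sum_(i < n) v 0 i ^+ 2 <= 1].

Definition open_disk (R : realType) (n : nat) : set 'rV[R]_n :=
  [set v | \sum_(i < n) v 0 i ^+ 2 < 1].

Definition sphere (R : realType) (n : nat) : set 'rV[R]_n :=
  [set v | \sum_(i < n) v 0 i ^+ 2 = 1].

(* Whitehead's definition, by characteristic maps defined on closed disks (the
   values of [cw_char i] outside the disk are irrelevant). Each characteristic
   map is a homeomorphism from the open disk onto its cell: this follows from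
   injectivity, because the disk is compact, the space is Hausdorff, and the
   image of the sphere is disjoint from the cell by [cw_boundary] and
   [cw_disjoint]. *)
Record CWcomplex (R : realType) := {
  cw_space :> topologicalType;
  cw_cell : Type;
  cw_cell_dim : cw_cell -> nat;
  cw_char : forall i : cw_cell, 'rV[R]_(cw_cell_dim i) -> cw_space;
  cw_open_cell := fun i => cw_char (i := i) @` @open_disk R (cw_cell_dim i);
  cw_hausdorff : hausdorff_space cw_space;
  cw_continuous : forall i,
    {within @disk R (cw_cell_dim i), continuous (cw_char (i := i))};
  cw_injective : forall i,
    set_inj (@open_disk R (cw_cell_dim i)) (cw_char (i := i));
  cw_cover : \bigcup_i cw_open_cell i = [set: cw_space];
  cw_disjoint : trivIset [set: cw_cell] cw_open_cell;
  (* closure-finiteness *)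
  cw_boundary : forall i, exists J : set cw_cell,
    [/\ finite_set J, forall j, J j -> (cw_cell_dim j < cw_cell_dim i)%N &
        cw_char (i := i) @` @sphere R (cw_cell_dim i)
          `<=` \bigcup_(j in J) cw_open_cell j];
  (* weak topology *)
  cw_weak : forall C : set cw_space,
    (forall i, closed (@disk R (cw_cell_dim i) `&` cw_char (i := i) @^-1` C)) ->
    closed C
}.

(* +oo if the dimensions of the cells are unbounded, -oo for the empty complex *)
Definition cw_dim (R : realType) (Y : CWcomplex R) : \bar R :=
  ereal_sup (range (fun i : cw_cell Y => (cw_cell_dim i)%:R%:E)).

Definition has_CW_type (R : realType) (X : topologicalType) :=
  exists Y : CWcomplex R, homotopy_equiv R Y X.

(* This is a genuine minimum only under [has_CW_type R X]. *)
Definition hdim (R : realType) (X : topologicalType) : \bar R :=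
  ereal_inf [set d | exists Y : CWcomplex R,
                       homotopy_equiv R Y X /\ d = cw_dim Y].

(* Main.v *)
Require Import Defs.
From HB Require Import structures.
From mathcomp Require Import all_boot all_order all_algebra.
From mathcomp Require Import all_classical all_reals all_analysis.
From mathcomp Require Import ring lra zify.

(* Let [U_0, ..., U_(n-1)] be a good cover of a space [Y] homotopy equivalent to
   [X], and let [P] be the polyhedron of its nerve.

   [P] is homotopy equivalent to [Y]. A map [g : P -> Y] is obtained by composing
   the contractions of the intersections [U_s], each performed for a time that
   depends on the barycentric coordinates; the same formula gives a homotopy from
   any [u : W -> Y] to [g \o f] whenever [f : W -> P] is such that [u w] lies in
   [U_i] for all vertices [i] of the carrier of [f w]. Since [Y] need not be normal,
   such an [f] comes from a partition of unity on the CW complex [Z ~ Y] (CW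
   complexes are normal), pulled back along [Y -> Z].

   The maximal size [d + 1] of a simplex of the nerve is at least [hdim X + 1],
   because [P] is a CW complex of dimension [d]. If [s_1, ..., s_k] are simplices and
   the simplices on the remaining set [V] of vertices have at most [m] vertices, then
   [cat X <= k + m]: the union of the open stars of the vertices of [s_i] is
   contractible in [P], and the remaining points are covered by [m] disjoint unions of open stars of
   barycenters, one union for each dimension. So if one removes from the vertex set
   first a maximal simplex, then repeatedly a simplex as large as possible, the i-th
   removed simplex after the first one has at least [cat X - i] vertices; summing
   the sizes gives [n >= d + 1 + cat X (cat X - 1) / 2]. *)

Set Implicit Arguments.
Unset Strict Implicit.
Unset Printing Implicit Defensive.

Import Order.TTheory GRing.Theory Num.Theory.
Import numFieldNormedType.Exports.

Local Open Scope classical_set_scope.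
Local Open Scope ring_scope.

(** * Homotopy *)

Lemma continuous_near_eq (X Y : topologicalType) (f g : X -> Y) (x : X) :
  (\forall y \near x, f y = g y) -> {for x, continuous g} -> {for x, continuous f}.
Proof.
move=> fg gc; rewrite /prop_for /continuous_at (nbhs_singleton fg).
apply: cvg_trans gc; apply: near_eq_cvg.
by near do apply/esym.
Unshelve. all: by end_near. Qed.

Lemma continuous_pair (X Y Z : topologicalType) (f : X -> Y) (g : X -> Z) :
  continuous f -> continuous g -> continuous (fun x => (f x, g x)).
Proof. by move=> fc gc x; apply: cvg_pair; [exact: fc|exact: gc]. Qed.

Lemma continuousT_comp (X Y Z : topologicalType) (f : X -> Y) (g : Y -> Z) :
  continuous f -> continuous g -> continuous (g \o f).
Proof. by move=> fc gc x; apply: continuous_comp; [exact: fc|exact: gc]. Qed.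

Lemma continuous_comp_within (X Y Z : topologicalType) (A : set Y) (f : X -> Y)
    (g : Y -> Z) :
  continuous f -> (forall x, A (f x)) -> {within A, continuous g} ->
  continuous (g \o f).
Proof.
move=> fc fA /subspace_continuousP gc x.
apply: cvg_comp (gc _ (fA x)) => B /=; rewrite withinE => -[C Cn CB].
apply: (@filterS _ (nbhs x) _ (f @^-1` C)); last exact: fc Cn.
by move=> y /= Cy; have : (C `&` A) (f y) by []; rewrite -CB => -[].
Qed.

Lemma near_snd (X Y : topologicalType) (x : X) (y : Y) (P : Y -> Prop) :
  (\forall z \near y, P z) -> \forall p \near (x, y), P p.2.
Proof. by move=> yP; exact: (@cvg_snd _ _ (nbhs x) (nbhs y) _ _ yP). Qed.

Definition clamp (R : realType) (t : R) : R := Order.max 0 (Order.min 1 t).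

Lemma clamp_continuous (R : realType) : continuous (@clamp R).
Proof.
move=> t; apply: (@continuous_max R R (cst 0) (fun t : R => Order.min 1 t)).
  exact: cvg_cst.
apply: (@continuous_min R R (cst 1) (fun t : R => t)); first exact: cvg_cst.
exact: cvg_id.
Qed.

Lemma clamp01 (R : realType) (t : R) : 0 <= clamp t <= 1.
Proof. by rewrite /clamp le_max lexx ge_max ler01 ge_min lexx. Qed.

Lemma clamp_le0 (R : realType) (t : R) : t <= 0 -> clamp t = 0.
Proof. by move=> t0; rewrite /clamp max_l // ge_min t0 orbT. Qed.

Lemma clamp_ge1 (R : realType) (t : R) : 1 <= t -> clamp t = 1.
Proof. by move=> t1; rewrite /clamp min_l // max_r. Qed.

Lemma clamp_id (R : realType) (t : R) : 0 <= t <= 1 -> clamp t = t.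
Proof. by move=> /andP[t0 t1]; rewrite /clamp min_r // max_r. Qed.

Lemma clamp_snd_continuous (R : realType) (X : topologicalType) :
  continuous (fun p : X * R => (p.1, clamp p.2)).
Proof.
apply: (@continuous_pair _ _ _ fst (@clamp R \o snd)) => p; first exact: cvg_fst.
by apply: continuous_comp; [exact: cvg_snd|exact: clamp_continuous].
Qed.

(** Clamping the time extends a homotopy to all real times, stationary outside [[0, 1]]. Continuity
    then holds on a full product, which spares the subspace topology in all later constructions. *)
Lemma homotopicP (R : realType) (X Y : topologicalType) (f g : X -> Y) :
  homotopic R f g <->
  exists H : X * R -> Y, [/\ continuous H,
    forall x t, t <= 0 -> H (x, t) = f x & forall x t, 1 <= t -> H (x, t) = g x].
Proof.
split=> [[H [Hc H0 H1]]|[H [Hc H0 H1]]]; last first.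
  exists H; split; [exact: continuous_subspaceT|by move=> x; rewrite H0|].
  by move=> x; rewrite H1.
pose k (p : X * R) := (p.1, clamp p.2).
have kc : continuous k by exact: clamp_snd_continuous.
have kA p : ([set: X] `*` `[0, 1]) (k p) by split => //=; rewrite in_itv /= clamp01.
exists (H \o k); split=> [|x t t0|x t t1] /=.
- exact: (continuous_comp_within kc kA Hc).
- by rewrite /k /= clamp_le0.
- by rewrite /k /= clamp_ge1.
Qed.

Lemma continuousM_snd (R : realType) (X : topologicalType) (a b : R) :
  continuous (fun p : X * R => (p.1, a * p.2 + b)).
Proof.
apply: (@continuous_pair _ _ _ fst (fun p : X * R => a * p.2 + b)) => p.
  exact: cvg_fst.
apply: cvgD; last exact: cvg_cst.
by apply: cvgM; [exact: cvg_cst|exact: cvg_snd].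
Qed.

Lemma homotopic_refl (R : realType) (X Y : topologicalType) (f : X -> Y) :
  continuous f -> homotopic R f f.
Proof.
move=> fc; apply/homotopicP; exists (f \o fst); split => //.
have c1 : continuous (@fst X R) by move=> p; exact: cvg_fst.
exact: (continuousT_comp c1 fc).
Qed.

Lemma homotopic_sym (R : realType) (X Y : topologicalType) (f g : X -> Y) :
  homotopic R f g -> homotopic R g f.
Proof.
move=> /homotopicP[H [Hc H0 H1]]; apply/homotopicP.
exists (H \o (fun p : X * R => (p.1, -1 * p.2 + 1))); split=> [|x t t0|x t t1] /=.
- exact: (continuousT_comp (@continuousM_snd _ _ _ _) Hc).
- by rewrite H1 //; lra.
- by rewrite H0 //; lra.
Qed.

Lemma homotopic_trans (R : realType) (X Y : topologicalType) (f g h : X -> Y) :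
  homotopic R f g -> homotopic R g h -> homotopic R f h.
Proof.
move=> /homotopicP[H [Hc H0 H1]] /homotopicP[K [Kc K0 K1]]; apply/homotopicP.
have Ic a b : continuous (H \o (fun p : X * R => (p.1, a * p.2 + b))).
  exact: (continuousT_comp (@continuousM_snd _ _ _ _) Hc).
have Jc a b : continuous (K \o (fun p : X * R => (p.1, a * p.2 + b))).
  exact: (continuousT_comp (@continuousM_snd _ _ _ _) Kc).
(* [H] is run during [[0, 1/3]] and [K] during [[2/3, 1]]. In between [L] rests at [g], so both
   branches agree near the cut at [1/2] and continuity is a local matter. *)
pose L (p : X * R) := if p.2 <= 2^-1 then H (p.1, 3 * p.2 + 0)
                      else K (p.1, 3 * p.2 + -2).
exists L; split=> [[x t]|x t t0|x t t1]; last 2 first.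
- by rewrite /L /= ifT ?H0 //; lra.
- by rewrite /L /= ifF ?K1 //; lra.
have [t2|t2] := leP t 2^-1.
- apply: continuous_near_eq (Ic 3 0 _).
  have : \forall p \near (x, t), p.2 < 2 / 3 :> R.
    by apply: (@near_snd _ _ x t (fun s : R => s < 2 / 3)); apply: lt_nbhsl; lra.
  apply: filterS => -[y s] /= s2; rewrite /L /=; case: ifPn => //.
  by rewrite -ltNge => ?; rewrite H1 ?K0 //; lra.
- apply: continuous_near_eq (Jc 3 (-2) _).
  have : \forall p \near (x, t), p.2 > 1 / 3 :> R.
    by apply: (@near_snd _ _ x t (fun s : R => s > 1 / 3)); apply: lt_nbhsr; lra.
  apply: filterS => -[y s] /= s2; rewrite /L /=; case: ifPn => //.
  by move=> ?; rewrite H1 ?K0 //; lra.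
Qed.

Lemma homotopic_compl (R : realType) (X Y Z : topologicalType) (f g : X -> Y)
    (k : Y -> Z) :
  continuous k -> homotopic R f g -> homotopic R (k \o f) (k \o g).
Proof.
move=> kc /homotopicP[H [Hc H0 H1]]; apply/homotopicP; exists (k \o H).
split=> [|x t t0|x t t1]; first exact: (continuousT_comp Hc kc).
  by rewrite /= H0.
by rewrite /= H1.
Qed.

Lemma homotopic_compr (R : realType) (X Y Z : topologicalType) (f g : X -> Y)
    (k : Z -> X) :
  continuous k -> homotopic R f g -> homotopic R (f \o k) (g \o k).
Proof.
move=> kc /homotopicP[H [Hc H0 H1]]; apply/homotopicP.
exists (H \o (fun p : Z * R => (k p.1, p.2))).
split=> [|x t t0|x t t1]; last 2 first.
- by rewrite /= H0.
- by rewrite /= H1.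
have kkc : continuous (fun p : Z * R => (k p.1, p.2)).
  apply: (@continuous_pair _ _ _ (k \o fst) snd) => p; last exact: cvg_snd.
  by apply: (@continuous_comp _ _ _ fst k); [exact: cvg_fst|exact: kc].
exact: (continuousT_comp kkc Hc).
Qed.

Lemma homotopy_equiv_sym (R : realType) (X Y : topologicalType) :
  homotopy_equiv R X Y -> homotopy_equiv R Y X.
Proof. by move=> [f [g [fc gc gf fg]]]; exists g, f. Qed.

Lemma homotopy_equiv_trans (R : realType) (X Y Z : topologicalType) :
  homotopy_equiv R X Y -> homotopy_equiv R Y Z -> homotopy_equiv R X Z.
Proof.
move=> [f [g [fc gc gf fg]]] [h [k [hc kc kh hk]]].
exists (h \o f), (g \o k); split; [exact: (continuousT_comp fc hc)|exact: (continuousT_comp kc gc)| |].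
- apply: homotopic_trans gf; apply: (homotopic_compl gc).
  exact: (homotopic_compr fc kh).
- apply: homotopic_trans hk; apply: (homotopic_compl hc).
  exact: (homotopic_compr kc fg).
Qed.

(** * Polyhedra in barycentric coordinates *)

Definition in_sub (T : Type) (A : set T) (x : T) (Ax : A x) : A :=
  exist (fun y => y \in A) x (mem_set Ax).

Lemma set_val_continuous (X : topologicalType) (A : set X) :
  continuous (set_val : A -> X).
Proof. exact: initial_continuous. Qed.

Lemma continuous_into_sub (X Y : topologicalType) (A : set Y) (f : X -> A) :
  continuous (set_val \o f) -> continuous f.
Proof. exact: continuous_comp_initial. Qed.

Lemma continuous_into_row (R : realType) (X : topologicalType) (n : nat)
    (f : X -> 'rV[R]_n) (x : X) :
  (forall i, {for x, continuous (fun y => f y 0 i)}) -> {for x, continuous f}.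
Proof.
move=> fc A [P Pn PA].
have : \forall y \near x, forall i j, P i j (f y i j).
  apply: filter_forall => i; apply: filter_forall => j.
  by have := fc j (P i j); rewrite -(ord1 i) => /(_ (Pn i j)).
by apply: filterS => y Py; apply: PA.
Qed.

Lemma row_coord_continuous (R : realType) (X : topologicalType) (n : nat)
    (f : X -> 'rV[R]_n) (i : 'I_n) :
  continuous f -> continuous (fun x => f x 0 i).
Proof. by move=> fc; exact: (continuousT_comp fc (@coord_continuous _ _ _ _ _)). Qed.

Definition supp (R : realType) (n : nat) (t : 'rV[R]_n) : {set 'I_n} :=
  [set i | 0 < t 0 i].

(** The geometric realization of [K], with the topology of the ambient [R^n]. *)
Definition polyhedron (R : realType) (n : nat) (K : pred {set 'I_n}) :
    set 'rV[R]_n :=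
  [set t : 'rV[R]_n | [/\ forall i, 0 <= t 0 i, \sum_i t 0 i = 1 & K (supp t)]].

Definition complex (n : nat) (K : pred {set 'I_n}) :=
  forall s t : {set 'I_n}, s \subset t -> K t -> K s.

Section Polyhedron.
Variables (R : realType) (n : nat) (K : pred {set 'I_n}).
Hypothesis Kc : complex K.

Let P := polyhedron (R := R) K.

Lemma polyhedronP (p : P) :
  [/\ forall i, 0 <= set_val p 0 i, \sum_i set_val p 0 i = 1 & K (supp (set_val p))].
Proof. exact: (set_valP p). Qed.

Lemma polyhedron_supp_neq0 (t : 'rV[R]_n) : P t -> supp t != finset.set0.
Proof.
move=> [t0 t1 _]; apply/finset.set0Pn; apply: contrapT => s0.
suff : \sum_i t 0 i = 0 by rewrite t1 => /eqP; rewrite oner_eq0.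
apply: big1 => i _; apply/eqP; rewrite eq_le t0 andbT leNgt.
by apply/negP => ti; apply: s0; exists i; rewrite inE.
Qed.

Lemma continuous_into_polyhedron (W : topologicalType) (f : W -> P) :
  (forall i, continuous (fun w => set_val (f w) 0 i)) -> continuous f.
Proof.
move=> fc; apply: continuous_into_sub => w; apply: continuous_into_row => i.
exact: fc.
Qed.

Lemma polyhedron_coord_continuous (W : topologicalType) (f : W -> P) i :
  continuous f -> continuous (fun w => set_val (f w) 0 i).
Proof.
move=> fc; apply: (@row_coord_continuous _ _ _ (set_val \o f)).
exact: (continuousT_comp fc (@set_val_continuous _ _)).
Qed.

Lemma segment_polyhedron (p q : P) (t : R) :
  K (supp (set_val p) :|: supp (set_val q)) ->
  P ((1 - clamp t) *: set_val p + clamp t *: set_val q).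
Proof.
have [p0 p1 _] := polyhedronP p; have [q0 q1 _] := polyhedronP q => Kpq.
have /andP[c0 c1] := clamp01 t; split.
- by move=> i; rewrite !mxE addr_ge0 // mulr_ge0 // subr_ge0.
- under eq_bigr do rewrite !mxE.
  by rewrite big_split /= -!mulr_sumr p1 q1; ring.
- apply: Kc Kpq; apply/fintype.subsetP => i; rewrite !inE !mxE.
  apply: contraTT; rewrite negb_or -!leNgt => /andP[pi qi].
  have -> : set_val p 0 i = 0 by apply/eqP; rewrite eq_le pi p0.
  have -> : set_val q 0 i = 0 by apply/eqP; rewrite eq_le qi q0.
  by rewrite !mulr0 addr0.
Qed.

(** Contiguous maps: [f w] and [g w] lie in a common simplex, so the segment between them stays in
    the polyhedron. *)
Lemma linear_homotopy (W : topologicalType) (f g : W -> P) :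
  continuous f -> continuous g ->
  (forall w, K (supp (set_val (f w)) :|: supp (set_val (g w)))) ->
  homotopic R f g.
Proof.
move=> fc gc Kfg; apply/homotopicP.
exists (fun p => in_sub (segment_polyhedron p.2 (Kfg p.1))).
split=> [|w t t0|w t t1].
- apply: continuous_into_polyhedron => i.
  have -> : (fun p : W * R => set_val (in_sub (segment_polyhedron p.2 (Kfg p.1))) 0 i)
    = (fun p => (1 - clamp p.2) * set_val (f p.1) 0 i
                + clamp p.2 * set_val (g p.1) 0 i).
    by apply/funext => p; rewrite !mxE.
  have cc : continuous (fun p : W * R => clamp p.2).
    by move=> p; apply: continuous_comp; [exact: cvg_snd|exact: clamp_continuous].
  have c1 : continuous (@fst W R) by move=> p; exact: cvg_fst.
  have cf := continuousT_comp c1 (polyhedron_coord_continuous (i := i) fc).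
  have cg := continuousT_comp c1 (polyhedron_coord_continuous (i := i) gc).
  move=> p; apply: cvgD; apply: cvgM.
  + by apply: cvgB; [exact: cvg_cst|exact: cc].
  + exact: cf.
  + exact: cc.
  + exact: cg.
- by apply: val_inj; rewrite /= clamp_le0 // subr0 scale1r scale0r addr0.
- by apply: val_inj; rewrite /= clamp_ge1 // subrr scale1r scale0r add0r.
Qed.

End Polyhedron.

(** * Chains of dominant faces *)

Section RealContinuity.
Variables (R : realType) (W : topologicalType) (f g : W -> R) (x : W).
Hypotheses (fc : {for x, continuous f}) (gc : {for x, continuous g}).

Lemma continuous_add : {for x, continuous (fun y => f y + g y)}.
Proof. exact: cvgD fc gc. Qed.

Lemma continuous_sub : {for x, continuous (fun y => f y - g y)}.
Proof. exact: cvgB fc gc. Qed.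

Lemma continuous_mul : {for x, continuous (fun y => f y * g y)}.
Proof. exact: cvgM fc gc. Qed.

Lemma continuous_div : g x != 0 -> {for x, continuous (fun y => f y / g y)}.
Proof. by move=> gx; apply: cvgM fc _; apply: cvgV gc. Qed.

Lemma continuous_cst (c : R) : {for x, continuous (fun _ : W => c)}.
Proof. exact: cvg_cst. Qed.

End RealContinuity.

Lemma continuous_bigmin (R : realType) (W : topologicalType) (I : finType)
    (Q : pred I) (F : I -> W -> R) (x0 : R) :
  (forall i, continuous (F i)) ->
  continuous (fun w => \big[Order.min/x0]_(i | Q i) F i w).
Proof.
move=> Fc; apply: (@continuous_big R) => [p|i _]; last exact: Fc.
apply: (@continuous_min R (R * R)%type fst snd); [exact: cvg_fst|exact: cvg_snd].
Qed.

Lemma continuous_bigmax (R : realType) (W : topologicalType) (I : finType)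
    (Q : pred I) (F : I -> W -> R) (x0 : R) :
  (forall i, continuous (F i)) ->
  continuous (fun w => \big[Order.max/x0]_(i | Q i) F i w).
Proof.
move=> Fc; apply: (@continuous_big R) => [p|i _]; last exact: Fc.
apply: (@continuous_max R (R * R)%type fst snd); [exact: cvg_fst|exact: cvg_snd].
Qed.

(* The sets [s] with [0 < gap s t] form a chain of faces of the carrier of [t]. *)
Definition gap (R : realType) (n : nat) (s : {set 'I_n}) (t : 'rV[R]_n) : R :=
  \big[Order.min/1]_(i in s) t 0 i - \big[Order.max/0]_(i in ~: s) t 0 i.

Definition max_gap (R : realType) (n : nat) (t : 'rV[R]_n) : R :=
  \big[Order.max/0]_(s : {set 'I_n} | s != finset.set0) gap s t.

(** A closed condition with a margin: the gap is at least half of the maximal one, hence positive on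
    the polyhedron, and an inactive set stays inactive nearby. *)
Definition active (R : realType) (n : nat) (s : {set 'I_n}) (t : 'rV[R]_n) : bool :=
  max_gap t <= 2 * gap s t.

(** A continuous cut-off: [0] when the gap is at most half of the maximum, [1] when it attains the
    maximum. *)
Definition activity (R : realType) (n : nat) (s : {set 'I_n}) (t : 'rV[R]_n) : R :=
  clamp ((2 * gap s t - max_gap t) / max_gap t).

Section Gap.
Variables (R : realType) (n : nat).
Implicit Types (s : {set 'I_n}) (t : 'rV[R]_n).

Lemma gap_continuous s : continuous (@gap R n s).
Proof.
have cc i := @coord_continuous R 1 n 0 i.
have c1 := continuous_bigmin (Q := mem s) (x0 := 1) cc.
have c0 := continuous_bigmax (Q := mem (~: s)) (x0 := 0) cc.
by move=> t; exact: continuous_sub (c1 t) (c0 t).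
Qed.

Lemma max_gap_continuous : continuous (@max_gap R n).
Proof.
exact: (continuous_bigmax gap_continuous).
Qed.

Lemma gap_gt0_lt s t i j : 0 < gap s t -> i \in s -> j \notin s -> t 0 j < t 0 i.
Proof.
rewrite subr_gt0 => st is_ js.
apply: (@le_lt_trans _ _ (\big[Order.max/0]_(i in ~: s) t 0 i)).
  by apply: (le_bigmax_cond _ (fun i => t 0 i)); rewrite inE.
by apply: lt_le_trans st _; apply: (bigmin_le_cond _ (fun i => t 0 i)).
Qed.

(** For [i] in [s] but not [s'] and [j] in [s'] but not [s], the two gaps would give both
    [t j < t i] and [t i < t j]. *)
Lemma gap_gt0_subset s s' t : 0 < gap s t -> 0 < gap s' t ->
  (s \subset s') || (s' \subset s).
Proof.
move=> sgt s'gt; case: (boolP (s \subset s')) => //= /fintype.subsetPn[i is_ is'].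
apply/fintype.subsetP => j js'; apply: contraT => js.
by have := lt_trans (gap_gt0_lt sgt is_ js) (gap_gt0_lt s'gt js' is'); rewrite ltxx.
Qed.

(** The maximum in [gap] has default value [0], so a positive gap forces positive coordinates on
    [s], even if [s] contains every index. *)
Lemma gap_gt0_supp s t : 0 < gap s t -> s \subset supp t.
Proof.
rewrite subr_gt0 => st; apply/fintype.subsetP => i is_; rewrite inE.
apply: (@le_lt_trans _ _ (\big[Order.max/0]_(i in ~: s) t 0 i)).
  exact: bigmax_ge_id.
by apply: lt_le_trans st _; apply: (bigmin_le_cond _ (fun i => t 0 i)).
Qed.

Variable K : pred {set 'I_n}.

Lemma polyhedron_le1 t i : polyhedron K t -> t 0 i <= 1.
Proof.
move=> [t0 t1 _]; rewrite -t1 (bigD1 i) //= lerDl; apply: sumr_ge0 => j _.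
exact: t0.
Qed.

Lemma max_gap_gt0 t : polyhedron K t -> 0 < max_gap t.
Proof.
move=> Pt; have [t0 _ _] := Pt.
have /finset.set0Pn[i0 i0t] := polyhedron_supp_neq0 Pt.
pose i := [arg max_(i > i0) t 0 i]%O.
have ti j : t 0 j <= t 0 i by rewrite /i; case: arg_maxP => // k _; apply.
have ti0 : 0 < t 0 i by apply: lt_le_trans (ti i0); move: i0t; rewrite inE.
(* The vertices of largest coordinate have a positive gap; the default value [1] of the minimum does
   no harm, since barycentric coordinates are at most [1]. *)
pose s : {set 'I_n} := [set j | t 0 j == t 0 i]%SET.
have sN : s != finset.set0 by apply/finset.set0Pn; exists i; rewrite inE.
have le_max : gap s t <= max_gap t.
  exact: (@le_bigmax_cond _ _ _ _ s (fun s => s != finset.set0) (fun s => gap s t)).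
apply: lt_le_trans le_max; rewrite subr_gt0.
apply: (@lt_le_trans _ _ (t 0 i)).
  apply/bigmax_ltP; split=> // j; rewrite !inE => jt.
  by rewrite lt_neqAle jt ti.
apply/bigmin_geP; split=> [|j]; first exact: polyhedron_le1 Pt.
by rewrite inE => /eqP ->.
Qed.

Lemma active_gap_gt0 s t : polyhedron K t -> active s t -> 0 < gap s t.
Proof. by move=> /max_gap_gt0 M0 /(lt_le_trans M0); rewrite pmulr_rgt0. Qed.

Lemma activity_inactive s t : polyhedron K t -> ~~ active s t -> activity s t = 0.
Proof.
move=> /max_gap_gt0 M0; rewrite -ltNge => sM; apply: clamp_le0.
by rewrite pmulr_lle0 ?invr_gt0 // subr_le0 ltW.
Qed.

Lemma exists_activity1 t : polyhedron K t ->
  exists s, [/\ s != finset.set0, active s t & activity s t = 1].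
Proof.
move=> /max_gap_gt0 M0.
(* The maximum is positive, so it is attained by some set and not by the default value [0] alone. *)
have [s sN sM] : exists2 s : {set 'I_n}, s != finset.set0 & gap s t = max_gap t.
  apply: contrapT => h; suff : max_gap t < max_gap t by rewrite ltxx.
  apply/bigmax_ltP; split=> // s sN; rewrite lt_neqAle; apply/andP; split.
    by apply/eqP => sM; apply: h; exists s.
  exact: (@le_bigmax_cond _ _ _ _ s (fun s => s != finset.set0) (fun s => gap s t)).
exists s; split=> //; first by rewrite /active sM; lra.
apply: clamp_ge1; rewrite sM; have -> : 2 * max_gap t - max_gap t = max_gap t by ring.
by rewrite divff // gt_eqF.
Qed.

Lemma near_inactive s t : ~~ active s t -> \forall u \near t, ~~ active s u.
Proof.
rewrite -ltNge -subr_gt0 => st.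
have gc := continuous_mul (@continuous_cst R _ t 2) (@gap_continuous s t).
have h := cvgr_gt (max_gap t - 2 * gap s t) (continuous_sub (@max_gap_continuous t) gc) _ st.
by near=> u; rewrite -ltNge -subr_gt0; near: u; exact: h.
Unshelve. all: by end_near. Qed.

Lemma activity_continuous s t : polyhedron K t -> {for t, continuous (@activity R n s)}.
Proof.
move=> /max_gap_gt0 M0; have Mn : max_gap t != 0 by rewrite gt_eqF.
apply: (@continuous_comp _ _ _
  (fun t : 'rV[R]_n => (2 * gap s t - max_gap t) / max_gap t) (@clamp R)).
  have gc := continuous_mul (@continuous_cst R _ t 2) (@gap_continuous s t).
  have mc := @max_gap_continuous t; exact: (continuous_div (continuous_sub gc mc) mc Mn).
exact: clamp_continuous.
Qed.

End Gap.

(** * The map from the nerve to the space *)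

(** As [A] is open, neighborhoods in the subspace [A] are neighborhoods in [Y]; this lets partial
    maps be handled as total ones. *)
Lemma continuous_extend_open (R : realType) (Y Z : topologicalType) (A : set Y)
    (F : A * R -> Z) (F' : Y * R -> Z) :
  open A -> continuous F ->
  (forall y a (Ay : A y), F' (y, a) = F (in_sub Ay, a)) ->
  forall y a, A y -> {for (y, a), continuous F'}.
Proof.
move=> Ao Fc FF' y a Ay B; rewrite (FF' _ _ Ay) => /Fc [[V T] /= [Vn Tn] VT].
have [G [Go Gy GV]] : exists G, [/\ open G, G y & forall z (Az : A z), G z -> V (in_sub Az)].
  case: Vn => _ [[G Go <-] Gy GV]; exists G; split=> // z Az Gz.
  exact: GV.
exists (G `&` A, T).
  by split=> //=; apply: open_nbhs_nbhs; split=> //; exact: openI.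
move=> [z b] [/= [Gz Az] Tb]; rewrite /= (FF' _ _ Az).
by apply: VT; split=> //=; exact: GV.
Qed.

(* A contraction of [A] to a point, as a total function that is meaningful on [A] only. *)
Definition contraction (R : realType) (Y : topologicalType) (A : set Y)
    (c : Y * R -> Y) :=
  forall y, A y ->
    [/\ forall a, A (c (y, a)), forall a, a <= 0 -> c (y, a) = y,
        forall a z, 1 <= a -> A z -> c (y, a) = c (z, a) & forall a, {for (y, a), continuous c}].

Lemma contractible_contraction (R : realType) (Y : topologicalType) (A : set Y) :
  open A -> contractible_set R A -> exists c : Y * R -> Y, contraction A c.
Proof.
move=> Ao [x0 /homotopicP[H [Hc H0 H1]]].
pose c (p : Y * R) := if pselect (A p.1) is left h
  then set_val (H (in_sub h, p.2)) else p.1.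
have cH y a (Ay : A y) : c (y, a) = set_val (H (in_sub Ay, a)).
  by rewrite /c /=; case: pselect => // h; congr (set_val (H (_, _))); exact: val_inj.
exists c => y Ay; split.
- by move=> a; rewrite (cH _ _ Ay); exact: set_valP.
- by move=> a a0; rewrite (cH _ _ Ay) H0.
- by move=> a z a1 Az; rewrite (cH _ _ Ay) (cH _ _ Az) !H1.
- move=> a; apply: (continuous_extend_open Ao _ cH Ay).
  exact: (continuousT_comp Hc (@set_val_continuous _ _)).
Qed.

Definition meet_family (Y : Type) (n : nat) (U : 'I_n -> set Y) (s : {set 'I_n}) : set Y :=
  [set y | forall i, i \in s -> U i y].

(** The empty set is a member as soon as [Y] is inhabited, hence the separate condition that
    simplices be non-empty. *)
Definition nerve (Y : Type) (n : nat) (U : 'I_n -> set Y) : pred {set 'I_n} :=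
  [pred s | `[< meet_family U s !=set0 >]].

Lemma meet_familyS (Y : Type) (n : nat) (U : 'I_n -> set Y) (s t : {set 'I_n}) :
  s \subset t -> meet_family U t `<=` meet_family U s.
Proof. by move=> /fintype.subsetP st y ty i /st; exact: ty. Qed.

Lemma nerve_complex (Y : Type) (n : nat) (U : 'I_n -> set Y) : complex (nerve U).
Proof.
move=> s t st /asboolP[y ty]; apply/asboolP; exists y; exact: meet_familyS ty.
Qed.

Section NerveMap.
Variables (R : realType) (Y : topologicalType) (n : nat) (U : 'I_n -> set Y).
Variable c : {set 'I_n} -> Y * R -> Y.
Hypothesis Uo : forall i, open (U i).
Hypothesis cU : forall s : {set 'I_n},
  s != finset.set0 -> contraction (meet_family U s) (c s).

Let P := polyhedron (R := R) (nerve U).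
Local Notation meet := (meet_family U).

(** The invariant of the flow below: [y] lies in the domain of every contraction still to be
    performed. *)
Let good (L : seq {set 'I_n}) (y : Y) (t : 'rV[R]_n) :=
  forall s, s \in L -> active s t -> meet s y.

Let step (t : 'rV[R]_n) (u : R) (y : Y) (s : {set 'I_n}) :=
  if active s t then c s (y, u * activity s t) else y.

(* The contractions are performed one after the other, each for a time given
   by its activity; when one of them is completed the starting point is forgotten. *)
Let flow (L : seq {set 'I_n}) (y : Y) (t : 'rV[R]_n) (u : R) := foldl (step t u) y L.

Let decreasing := pairwise (fun s t : {set 'I_n} => #|t| <= #|s|)%N.

Lemma meet_family_open (s : {set 'I_n}) : open (meet s).
Proof.
rewrite openE => y ys; apply: filter_forall => i.
have [is_|is_] := boolP (i \in s); last exact: nearW.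
by near do move=> _; apply: open_nbhs_nbhs; split; [exact: Uo|exact: ys].
Unshelve. all: by end_near. Qed.

(** Active sets form a chain and larger ones come first, so a later active [s'] is contained in [s],
    and a contraction inside [meet s] does not leave [meet s']. *)
Lemma step_good s L y t u : P t -> decreasing (s :: L) -> s != finset.set0 ->
  good (s :: L) y t -> good L (step t u y s) t.
Proof.
move=> Pt /= /andP[/allP sL _] sN gy s' s'L as'; rewrite /step.
have [as_|as_] := boolP (active s t); last by apply: gy as'; rewrite inE s'L orbT.
have [Us _ _ _] := cU sN (gy s (mem_head _ _) as_).
apply: meet_familyS (Us _).
have /orP[ss'|//] := gap_gt0_subset (active_gap_gt0 Pt as_) (active_gap_gt0 Pt as').
by have /eqP-> : s == s' by rewrite finset.eqEcard ss' sL.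
Qed.

(** If [s] is inactive at [w], the step is the identity nearby. If it is active, [y w] lies in the
    open set [meet s], and nearby the step is [c s] run for time [u * activity], also where [s]
    becomes inactive, because that time is then [0]. *)
Lemma flow_continuous (W : topologicalType) (y : W -> Y) (t : W -> 'rV[R]_n)
    (u : W -> R) (w : W) L :
  {for w, continuous y} -> {for w, continuous t} -> {for w, continuous u} ->
  (forall w, P (t w)) -> decreasing L -> {in L, forall s, s != finset.set0} ->
  good L (y w) (t w) -> {for w, continuous (fun w => flow L (y w) (t w) (u w))}.
Proof.
move=> + tc uc Pt; elim: L y => [//|s L IH] y yc dL nL gy.
have sN : s != finset.set0 by apply: nL; rewrite mem_head.
have ac : {for w, continuous (fun w => activity s (t w))}.
  exact: (continuous_comp tc (activity_continuous (Pt w))).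
have [as_|as_] := boolP (active s (t w)); last first.
  have near_na : \forall v \near w, ~~ active s (t v).
    exact: tc (near_inactive as_).
  apply: (IH (fun w => step (t w) (u w) (y w) s)).
  - apply: (@continuous_near_eq _ _ _ y) => //.
    by apply: filterS near_na => v; rewrite /step => /negbTE ->.
  - by case/andP: dL.
  - by move=> r rL; apply: nL; rewrite inE rL orbT.
  - exact: step_good dL sN gy.
have ys : meet s (y w) by apply: gy => //; rewrite mem_head.
apply: (IH (fun w => step (t w) (u w) (y w) s)).
- apply: (@continuous_near_eq _ _ _ (fun v => c s (y v, u v * activity s (t v)))).
    have : \forall v \near w, meet s (y v).
      by apply: yc; apply: open_nbhs_nbhs; split=> //; exact: meet_family_open.
    apply: filterS => v yv; rewrite /step; case: ifPn => // nas.
    have [_ c0 _ _] := cU sN yv.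
    by rewrite c0 // (activity_inactive (Pt v) nas) mulr0.
  have [_ _ _ cc] := cU sN ys.
  apply: (@continuous_comp _ _ _ (fun v => (y v, u v * activity s (t v))) (c s)) => //.
  exact: (cvg_pair yc (continuous_mul uc ac)).
- by case/andP: dL.
- by move=> r rL; apply: nL; rewrite inE rL orbT.
- exact: step_good dL sN gy.
Qed.

Lemma flow0 L y t : {in L, forall s, s != finset.set0} -> P t ->
  decreasing L -> good L y t -> flow L y t 0 = y.
Proof.
move=> nL Pt; elim: L nL => [//|s L IH] nL dL gy /=.
have sN : s != finset.set0 by apply: nL; rewrite mem_head.
have E : step t 0 y s = y.
  rewrite /step; case: ifP => // as_; have [_ c0 _ _] := cU sN (gy s (mem_head _ _) as_).
  by rewrite mul0r c0.
rewrite E; apply: IH.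
- by move=> r rL; apply: nL; rewrite inE rL orbT.
- by case/andP: dL.
- by rewrite -E; exact: step_good dL sN gy.
Qed.

(** The two trajectories merge at the set of activity [1], whose contraction is completed. *)
Lemma flow1_indep L y z t : {in L, forall s, s != finset.set0} -> P t ->
  decreasing L -> good L y t -> good L z t ->
  (exists s, [/\ s \in L, active s t & activity s t = 1]) ->
  flow L y t 1 = flow L z t 1.
Proof.
move=> nL Pt; elim: L y z nL => [|s L IH] y z nL dL gy gz [r [rL ra r1]] //=.
have sN : s != finset.set0 by apply: nL; rewrite mem_head.
have [rs|rs] := eqVneq r s.
  subst r; rewrite /step ra mul1r r1.
  have [_ _ cy _] := cU sN (gy s (mem_head _ _) ra).
  by rewrite (cy _ z) //; exact: gz (mem_head _ _) ra.
apply: IH.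
- by move=> r' rL'; apply: nL; rewrite inE rL' orbT.
- by case/andP: dL.
- exact: step_good dL sN gy.
- exact: step_good dL sN gz.
- by exists r; split=> //; move: rL; rewrite inE (negbTE rs).
Qed.

(** Take for [s] the last active set of the list: its contraction ends in [meet s] and nothing moves
    afterwards. *)
Lemma flow_meet L y t (u : R) : {in L, forall s, s != finset.set0} -> P t ->
  decreasing L -> good L y t -> has (fun s => active s t) L ->
  exists s, [/\ s != finset.set0, active s t & meet s (flow L y t u)].
Proof.
move=> nL Pt; elim: L y nL => [//|s L IH] y nL dL gy /=.
have sN : s != finset.set0 by apply: nL; rewrite mem_head.
have [hL _|hL] := boolP (has (fun s => active s t) L).
  apply: IH hL.
  - by move=> r rL; apply: nL; rewrite inE rL orbT.
  - by case/andP: dL.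
  - exact: step_good dL sN gy.
rewrite orbF => as_; exists s; split=> //.
have E : foldl (step t u) (step t u y s) L = step t u y s.
  elim: L hL {IH nL dL gy} (step t u y s) => [//|r L IH] /=.
  by rewrite negb_or => /andP[ra rL] v; rewrite {2}/step (negbTE ra) IH.
rewrite /flow /= E /step as_; have [cm _ _ _] := cU sN (gy s (mem_head _ _) as_).
exact: cm.
Qed.

Let L0 : seq {set 'I_n} :=
  sort (fun s t : {set 'I_n} => #|t| <= #|s|)%N
    [seq s <- enum {set 'I_n} | s != finset.set0].

Lemma mem_L0 s : (s \in L0) = (s != finset.set0).
Proof. by rewrite mem_sort mem_filter mem_enum andbT. Qed.

Lemma L0_neq0 : {in L0, forall s, s != finset.set0}.
Proof. by move=> s; rewrite mem_L0. Qed.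

Lemma L0_decreasing : decreasing L0.
Proof.
rewrite /decreasing -sorted_pairwise; last by move=> x y z xy yz; exact: leq_trans yz xy.
by apply: sort_sorted => x y; exact: leq_total.
Qed.

Lemma good_supp L y t : P t -> meet (supp t) y -> good L y t.
Proof.
move=> Pt ty s _ /(active_gap_gt0 Pt)/gap_gt0_supp; exact: (fun st => meet_familyS st ty).
Qed.

Lemma exists_L0_activity1 t : P t ->
  exists s, [/\ s \in L0, active s t & activity s t = 1].
Proof.
by move=> /exists_activity1[s [sN ? ?]]; exists s; split=> //; rewrite mem_L0.
Qed.

(** [g p] is the end of the flow from a point chosen in the intersection over the carrier of [p].
    The choice is not continuous, but the end does not depend on it. *)
Lemma nerve_map_exists : exists g : P -> Y, [/\ continuous g,
  forall p : P, exists i, 0 < set_val p 0 i /\ U i (g p) &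
  forall (W : topologicalType) (u : W -> Y) (f : W -> P),
    continuous u -> continuous f ->
    (forall w i, 0 < set_val (f w) 0 i -> U i (u w)) -> homotopic R u (g \o f)].
Proof.
have /choice[y0 y0P] : forall p : P, exists y, meet (supp (set_val p)) y.
  by move=> p; have [_ _ /asboolP] := polyhedronP p.
have PP (p : P) : P (set_val p) by exact: set_valP.
pose g (p : P) := flow L0 (y0 p) (set_val p) 1.
have gE p y : good L0 y (set_val p) -> g p = flow L0 y (set_val p) 1.
  move=> gy; apply: flow1_indep => //; [exact: L0_neq0|exact: L0_decreasing| |].
    exact: good_supp.
  exact: exists_L0_activity1.
exists g; split.
- move=> p.
  (* No new set becomes active near [p], so the fixed starting point [y0 p] also computes [g] at
     nearby points. *)
  apply: (@continuous_near_eq _ _ _ (fun q : P => flow L0 (y0 p) (set_val q) 1)).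
    have near_s s : \forall q \near p, ~~ active s (set_val p) -> ~~ active s (set_val q).
      have [as_|as_] := boolP (active s (set_val p)).
        by apply: (@nearW _ (nbhs p) _ (nbhs_filter p)) => q.
      have na : \forall q \near p, ~~ active s (set_val q).
        exact: (@set_val_continuous _ _ p _ (near_inactive as_)).
      by apply: filterS na.
    have near_all := @filter_forall _ _ _ (nbhs p) (nbhs_filter p) near_s.
    apply: (@filterS _ (nbhs p) (nbhs_filter p) _ _ _ near_all) => q qp; apply: gE => s sL as_.
    apply: (good_supp (PP p) (y0P p) sL); apply: contraLR as_; exact: qp.
  have c0 : {for p, continuous (fun _ : P => y0 p)} by exact: cst_continuous.
  have c1 : {for p, continuous (fun _ : P => 1 : R)} by exact: cst_continuous.
  exact: (flow_continuous c0 (@set_val_continuous _ _ p) c1 PP L0_decreasing L0_neq0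
    (good_supp (PP p) (y0P p))).
- move=> p.
  have [s [/finset.set0Pn[i is_] as_ sg]] : exists s, [/\ s != finset.set0,
      active s (set_val p) & meet s (g p)].
    apply: flow_meet => //; [exact: L0_neq0|exact: L0_decreasing| |].
      exact: good_supp.
    have [s [sL as_ _]] := exists_L0_activity1 (PP p).
    by apply/hasP; exists s.
  exists i; split; last exact: sg.
  have /fintype.subsetP/(_ _ is_) := gap_gt0_supp (active_gap_gt0 (PP p) as_).
  by rewrite inE.
(* The flow started at [u w] is the homotopy: it is at [u w] at time [0] and at [g (f w)] at time
   [1]. *)
- move=> W u f uc fc Uuf.
  have gd w : good L0 (u w) (set_val (f w)).
    by apply: good_supp => // i; rewrite inE; exact: Uuf.
  apply/homotopicP; exists (fun p => flow L0 (u p.1) (set_val (f p.1)) (clamp p.2)).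
  split=> [p|w t t0|w t t1] /=.
  + have c1 : continuous (@fst W R) by move=> q; exact: cvg_fst.
    have c2 : continuous (@snd W R) by move=> q; exact: cvg_snd.
    have c3 := continuousT_comp c1 (continuousT_comp fc (@set_val_continuous _ _)).
    have c4 := continuousT_comp c2 (@clamp_continuous R).
    have c5 := continuousT_comp c1 uc.
    exact: (flow_continuous (c5 p) (c3 p) (c4 p)
      (fun q => PP (f q.1)) L0_decreasing L0_neq0 (gd p.1)).
  + by rewrite clamp_le0 // flow0 //; [exact: L0_neq0|exact: L0_decreasing].
  + by rewrite clamp_ge1 // -gE.
Qed.

End NerveMap.

(** * CW complexes are normal *)

Lemma continuous_sum (R : realType) (W : topologicalType) (I : finType)
    (Q : pred I) (F : I -> W -> R) :
  (forall i, continuous (F i)) -> continuous (fun w => \sum_(i | Q i) F i w).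
Proof.
move=> Fc; apply: (@continuous_big R) => [p|i _]; last exact: Fc.
exact: add_continuous.
Qed.

Lemma disk_closed (R : realType) (n : nat) : closed (@disk R n).
Proof.
have c : continuous (fun v : 'rV[R]_n => \sum_i v 0 i ^+ 2).
  apply: continuous_sum => i v.
  exact: (continuous_mul (@coord_continuous R 1 n 0 i v) (@coord_continuous R 1 n 0 i v)).
have -> : @disk R n = (fun v : 'rV[R]_n => \sum_i v 0 i ^+ 2) @^-1` [set x | x <= 1] by [].
by move/continuous_closedP : c => /(_ _ (@closed_le _ 1)).
Qed.

Lemma sphere_closed (R : realType) (n : nat) : closed (@sphere R n).
Proof.
have c : continuous (fun v : 'rV[R]_n => \sum_i v 0 i ^+ 2).
  apply: continuous_sum => i v.
  exact: (continuous_mul (@coord_continuous R 1 n 0 i v) (@coord_continuous R 1 n 0 i v)).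
have -> : @sphere R n = (fun v : 'rV[R]_n => \sum_i v 0 i ^+ 2) @^-1` [set x | x = 1] by [].
by move/continuous_closedP : c => /(_ _ (@closed_eq _ 1)).
Qed.

Lemma disk_compact (R : realType) (n : nat) : compact (@disk R n).
Proof.
have cb : compact [set v : 'rV[R]_n | forall i, `[-1, 1]%classic (v ord0 i)].
  by apply: (@rV_compact R n (fun=> `[-1, 1]%classic)) => i; exact: segment_compact.
apply: (subclosed_compact (@disk_closed R n) cb) => v vD i.
rewrite /= in_itv /= -ler_norml -(@expr_le1 _ 2) // -normrX ger0_norm ?sqr_ge0 //.
apply: le_trans vD; rewrite (bigD1 i) //= lerDl.
by apply: sumr_ge0 => j _; exact: sqr_ge0.
Qed.

Lemma disk_split (R : realType) (n : nat) (v : 'rV[R]_n) :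
  disk v -> open_disk v \/ sphere v.
Proof.
by rewrite /disk /open_disk /sphere /= le_eqVlt => /orP[/eqP|]; [right|left].
Qed.

Lemma open_disk_disk (R : realType) (n : nat) (v : 'rV[R]_n) : open_disk v -> disk v.
Proof. exact: ltW. Qed.

Lemma sphere_disk (R : realType) (n : nat) (v : 'rV[R]_n) : sphere v -> disk v.
Proof. by rewrite /disk /sphere /= => ->. Qed.

Section CWNormal.
Variables (R : realType) (Z : CWcomplex R).
Local Notation cell := (cw_cell Z).
Local Notation dim := (@cw_cell_dim R Z).
Local Notation chi := (@cw_char R Z).

(** The open cells partition [Z] and are parametrized injectively. Cell and coordinates are compared
    as a dependent pair because the length of the coordinate vector depends on the cell. *)
Lemma cw_coordinates : exists (c : Z -> cell) (x : forall z, 'rV[R]_(dim (c z))),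
  (forall z, open_disk (x z) /\ chi (x z) = z) /\
  (forall i (v : 'rV[R]_(dim i)), open_disk v ->
     existT (fun i => 'rV[R]_(dim i)) (c (chi v)) (x (chi v)) = existT _ i v).
Proof.
have /choice[p pP] : forall z : Z, exists p : {i & 'rV[R]_(dim i)},
    open_disk (projT2 p) /\ chi (projT2 p) = z.
  move=> z; have : [set: Z] z by [].
  by rewrite -(@cw_cover R Z) => -[i _ [v vD vz]]; exists (existT _ i v).
exists (fun z => projT1 (p z)), (fun z => projT2 (p z)); split=> // i v vD.
rewrite -sigT_eta; have [pD pv] := pP (chi v).
case: (p (chi v)) pD pv => j w /= wD wv.
have ij : j = i.
  apply: (@cw_disjoint R Z) => //; exists (chi v); split; last by exists v.
  by exists w.
subst j; congr existT.
by apply: (@cw_injective R Z i) => //; rewrite inE.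
Qed.

(** The sphere is mapped into finitely many closed cells of lower dimension. In each of them the
    preimage of a closed [T] under [f] has a compact, hence closed, trace [Q j]; the finite union of
    these traces pulls back to a closed set. *)
Lemma cw_sphere_continuous (f : Z -> R) (i : cell) :
  (forall j, (dim j < dim i)%N -> {within @disk R (dim j), continuous (f \o chi (i := j))}) ->
  {within @sphere R (dim i), continuous (f \o chi (i := i))}.
Proof.
move=> fc; have [J [Jf Jd JS]] := @cw_boundary R Z i.
apply/continuous_closedP => T Tc.
pose Q j := (chi (i := j)) @` (@disk R (dim j) `&` (f \o chi (i := j)) @^-1` T).
have Qc j : J j -> closed (Q j).
  move=> /Jd ji; apply: compact_closed; first exact: cw_hausdorff.
  have /continuous_closedP fjc := fc _ ji.
  have /closed_subspaceP[V Vc VT] := fjc _ Tc.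
  apply: continuous_compact.
    apply: continuous_subspaceW (@cw_continuous R Z j).
    by move=> v [].
  rewrite setIC -VT setIC; apply: compact_closedI => //; exact: disk_compact.
have QJc : closed (\bigcup_(j in J) Q j).
  by apply: (@closed_bigcup _ {classic cell}).
apply/closed_subspaceP.
have /continuous_closedP chic :
    {within @sphere R (dim i), continuous (chi (i := i))}.
  by apply: continuous_subspaceW (@cw_continuous R Z i) => v; exact: sphere_disk.
have /closed_subspaceP[V Vc VT] := chic _ QJc.
exists V => //; rewrite VT; apply/seteqP; split=> v [] /=.
  by move=> [j Jj [w [wD wT] wv]] vS; split=> //; exact: (eq_ind _ (fun z => T (f z)) wT _ wv).
move=> vT vS; split=> //.
have [j Jj [w wD wv]] := JS _ (ex_intro2 _ _ v vS erefl).
exists j => //; exists w; last by [].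
split; first exact: open_disk_disk.
exact: (eq_ind _ (fun z => T (f z)) vT _ (esym wv)).
Qed.
End CWNormal.

(** * Urysohn functions, built skeleton by skeleton *)

Section CWUrysohn.
Variables (R : realType) (Z : CWcomplex R) (A B : set Z).
Hypotheses (Ac : closed A) (Bc : closed B) (AB : A `&` B = set0).
Local Notation cell := (cw_cell Z).
Local Notation dim := (@cw_cell_dim R Z).
Local Notation chi := (@cw_char R Z).

Variables (c : Z -> cell) (x : forall z, 'rV[R]_(dim (c z))).
Hypothesis xP : forall z, open_disk (x z) /\ chi (x z) = z.
Hypothesis cx : forall i (v : 'rV[R]_(dim i)), open_disk v ->
  existT (fun i => 'rV[R]_(dim i)) (c (chi v)) (x (chi v)) = existT _ i v.

Let separates (f : Z -> R) :=
  [/\ forall z, A z -> f z = 0, forall z, B z -> f z = 1 & forall z, 0 <= f z <= 1].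

(** Continuity on the skeleton of dimension [k - 1], read through the characteristic maps; [k = 0]
    imposes nothing. *)
Let continuous_below (k : nat) (f : Z -> R) :=
  forall i, (dim i < k)%N -> {within @disk R (dim i), continuous (f \o chi (i := i))}.

Lemma dim_sphere i (v : 'rV[R]_(dim i)) : sphere v -> (dim (c (chi v)) < dim i)%N.
Proof.
move=> vS; have [J [_ Jd JS]] := @cw_boundary R Z i.
have [j Jj [w wD <-]] := JS _ (ex_intro2 _ _ v vS erefl).
by have /(congr1 (@projT1 _ _)) /= -> := cx wD; exact: Jd.
Qed.

Lemma dim_disk i (v : 'rV[R]_(dim i)) : disk v -> (dim (c (chi v)) <= dim i)%N.
Proof.
move=> /disk_split[vD|/dim_sphere /ltnW //].
by have /(congr1 (@projT1 _ _)) /= -> := cx vD.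
Qed.

Lemma within_preimage_closed i (C : set Z) : closed C ->
  closed (@disk R (dim i) `&` chi (i := i) @^-1` C).
Proof.
move=> Cc; have /continuous_closedP h := @cw_continuous R Z i.
have /closed_subspaceP[V Vc VC] := h _ Cc.
rewrite setIC -VC; apply: closedI => //; exact: disk_closed.
Qed.

(* Tietze extension from the sphere and the preimages of [A] and [B] *)
Lemma extend_cell (f : Z -> R) (i : cell) :
  separates f -> continuous_below (dim i) f ->
  exists g : 'rV[R]_(dim i) -> R, [/\ continuous g, forall v, 0 <= g v <= 1,
    forall v, sphere v -> g v = f (chi v),
    forall v, disk v -> A (chi v) -> g v = 0 &
    forall v, disk v -> B (chi v) -> g v = 1].
Proof.
move=> [fA fB f01] fc.
pose DA := @disk R (dim i) `&` chi (i := i) @^-1` A.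
pose DB := @disk R (dim i) `&` chi (i := i) @^-1` B.
pose S := @sphere R (dim i) `|` (DA `|` DB).
have DAc : closed DA by exact: within_preimage_closed.
have DBc : closed DB by exact: within_preimage_closed.
have Sc : closed S by apply: closedU; [exact: sphere_closed|exact: closedU].
(* Nothing is known about [f] inside the cell, but it is constant on each of the closed sets [DA]
   and [DB]. *)
have fS : {within S, continuous (f \o chi (i := i))}.
  apply: withinU_continuous; [exact: sphere_closed|exact: closedU| |].
    by apply: cw_sphere_continuous => j; exact: fc.
  apply: withinU_continuous => //.
    apply: (@subspace_eq_continuous _ DA R (fun=> 0)); last exact: cst_continuous.
    by move=> v; rewrite inE => -[_ vA]; exact/esym/fA.
  apply: (@subspace_eq_continuous _ DB R (fun=> 1)); last exact: cst_continuous.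
  by move=> v; rewrite inE => -[_ vB]; exact/esym/fB.
have [g [gf gc g1]] : exists g, [/\ {in S, f \o chi (i := i) =1 g}, continuous g &
    forall v, `|g v| <= 1].
  apply: (continuous_bounded_extension _ Sc ltr01 fS) => [|v _].
    exact: pseudometric_normal.
  by have /andP[f0 f1] := f01 (chi v); rewrite /= ger0_norm.
(* Tietze only bounds the absolute value of [g] by [1]; clamping removes negative values and changes
   nothing on [S]. *)
have gS v : S v -> clamp (g v) = f (chi v).
  by move=> Sv; rewrite -gf ?inE //= clamp_id.
exists (fun v => clamp (g v)); split.
- exact: (continuousT_comp gc (@clamp_continuous R)).
- by move=> v; exact: clamp01.
- by move=> v vS; rewrite gS //; left.
- by move=> v vD vA; rewrite gS ?fA //; right; left.
- by move=> v vD vB; rewrite gS ?fB //; right; right.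
Qed.

(** Only the values on open cells of dimension [k] are changed. Spheres go to lower cells, where the
    extension [g] agrees with the old [f], so the new function is [g] on the whole closed disk. *)
Lemma extend_skeleton (k : nat) (f : Z -> R) :
  separates f -> continuous_below k f ->
  exists f', [/\ separates f', continuous_below k.+1 f' &
    forall z, (dim (c z) < k)%N -> f' z = f z].
Proof.
move=> fs fc; have [fA fB f01] := fs.
have ext i : exists g : 'rV[R]_(dim i) -> R, dim i = k ->
   [/\ continuous g, forall v, 0 <= g v <= 1,
    forall v, sphere v -> g v = f (chi v),
    forall v, disk v -> A (chi v) -> g v = 0 &
    forall v, disk v -> B (chi v) -> g v = 1].
  have [ik|ik] := eqVneq (dim i) k; last by exists (cst 0) => /eqP; rewrite (negbTE ik).
  have [|g gP] := @extend_cell f i fs; first by rewrite ik.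
  by exists g.
pose g i := projT1 (cid (ext i)); have gP i := projT2 (cid (ext i)).
pose G (p : {i & 'rV[R]_(dim i)}) := g (projT1 p) (projT2 p).
pose f' z := if dim (c z) == k then G (existT _ (c z) (x z)) else f z.
have f'g i (v : 'rV[R]_(dim i)) : dim i = k -> disk v -> f' (chi v) = g i v.
  move=> ik /disk_split[vD|vS].
    have /= ci := congr1 (@projT1 _ _) (cx vD).
    by rewrite /f' (cx vD) ci ik eqxx.
  rewrite /f' ifF; first by have [_ _ h _ _] := gP i ik; exact/esym/h.
  by apply/ltn_eqF; rewrite -ik; exact: dim_sphere.
have f'f z : dim (c z) != k -> f' z = f z by rewrite /f' => /negbTE ->.
exists f'; split.
- split=> [z zA|z zB|z].
  + have [zk|/f'f ->] := eqVneq (dim (c z)) k; last exact: fA.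
    have [/open_disk_disk zD zx] := xP z; have [_ _ _ gA _] := gP _ zk.
    by rewrite -zx f'g //; apply: gA => //; rewrite zx.
  + have [zk|/f'f ->] := eqVneq (dim (c z)) k; last exact: fB.
    have [/open_disk_disk zD zx] := xP z; have [_ _ _ _ gB] := gP _ zk.
    by rewrite -zx f'g //; apply: gB => //; rewrite zx.
  + have [zk|/f'f -> //] := eqVneq (dim (c z)) k.
    have [/open_disk_disk zD zx] := xP z; have [_ g01 _ _ _] := gP _ zk.
    by rewrite -zx f'g //; exact: g01.
- move=> i; rewrite ltnS leq_eqVlt => /orP[/eqP ik|ik].
    have [gc _ _ _ _] := gP _ ik.
    apply: (@subspace_eq_continuous _ (@disk R (dim i)) R (g i)).
      by move=> v; rewrite inE => vD; rewrite -f'g.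
    exact: continuous_subspaceT.
  apply: (@subspace_eq_continuous _ (@disk R (dim i)) R (f \o chi (i := i))).
    move=> v; rewrite inE => vD; apply/esym/f'f.
    by rewrite ltn_eqF //; apply: leq_ltn_trans ik; exact: dim_disk.
  exact: fc.
- by move=> z zk; rewrite f'f // ltn_eqF.
Qed.

(** The value at a point is final from the stage after the dimension of its cell. On a closed cell
    the limit therefore equals a single stage, and the weak topology gives continuity. *)
Lemma cw_separation : exists f : Z -> R, continuous f /\ separates f.
Proof.
(* The construction may start from a discontinuous function, as no continuity is demanded at stage
   [0]. *)
pose f0 z : R := if `[< B z >] then 1 else 0.
have f0P : separates f0 /\ continuous_below 0 f0.
  split; last by [].
  split=> [z zA|z zB|z]; rewrite /f0.
  - by case: asboolP => // zB; have : (A `&` B) z by []; rewrite AB.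
  - by rewrite asboolT.
  - by case: asboolP; rewrite ler01 lexx.
have nextP (k : nat) (f : Z -> R) : exists f', separates f /\ continuous_below k f ->
    [/\ separates f', continuous_below k.+1 f' & forall z, (dim (c z) < k)%N -> f' z = f z].
  have [[fs fc]|nf] := pselect (separates f /\ continuous_below k f); last by exists f.
  by have [f' f'P] := extend_skeleton fs fc; exists f'.
pose next k f := projT1 (cid (nextP k f)).
pose F := fix F k := if k is k'.+1 then next k' (F k') else f0.
have FP k : separates (F k) /\ continuous_below k (F k).
  elim: k => [//|k /(projT2 (cid (nextP k (F k))))[]].
  by split.
have FE k m z : (dim (c z) < k)%N -> F (k + m)%N z = F k z.
  move=> zk; elim: m => [|m <-]; first by rewrite addn0.
  have [_ _] := projT2 (cid (nextP (k + m)%N (F (k + m)%N))) (FP _).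
  by rewrite addnS; apply; apply: leq_trans zk (leq_addr _ _).
exists (fun z => F (dim (c z)).+1 z); split.
  apply/continuous_closedP => T Tc; apply: cw_weak => i.
  have -> : @disk R (dim i) `&` chi (i := i) @^-1` ((fun z => F (dim (c z)).+1 z) @^-1` T)
      = @disk R (dim i) `&` (F (dim i).+1 \o chi (i := i)) @^-1` T.
    have E v : disk v -> F (dim (c (chi v))).+1 (chi v) = F (dim i).+1 (chi (i := i) v).
      by move=> /dim_disk vi; rewrite -(subnKC vi) -addSn FE.
    by apply/seteqP; split=> v [vD vT]; split=> //;
      [exact: (eq_ind _ T vT _ (E _ vD))|exact: (eq_ind _ T vT _ (esym (E _ vD)))].
  have [_ Fc] := FP (dim i).+1.
  have /continuous_closedP h := Fc i (ltnSn _).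
  have /closed_subspaceP[V Vc VT] := h _ Tc.
  by rewrite setIC -VT; apply: closedI => //; exact: disk_closed.
split=> z *; first by have [[h _ _] _] := FP (dim (c z)).+1; exact: h.
  by have [[_ h _] _] := FP (dim (c z)).+1; exact: h.
by have [[_ _ h] _] := FP (dim (c z)).+1; exact: h.
Qed.

End CWUrysohn.

Lemma cw_normal (R : realType) (Z : CWcomplex R) : normal_space Z.
Proof.
apply/(@normal_openP R) => A B Ac Bc AB.
have [c [x [xP cx]]] := @cw_coordinates R Z.
have [f [fc [fA fB _]]] := cw_separation Ac Bc AB xP cx.
exists (f @^-1` [set t | t < 2^-1]), (f @^-1` [set t | t > 2^-1]).
have /continuousP fo := fc.
split; [exact: fo (@open_lt _ _)|exact: fo (@open_gt _ _)| | |].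
- by move=> z /fA /= ->; rewrite invr_gt0.
- by move=> z /fB /= ->; rewrite invf_lt1 // ltr1n.
- by apply/seteqP; split=> // z [] /= /lt_trans h /h; rewrite ltxx.
Qed.

(** * The nerve theorem *)

(** The cover is shrunk one index at a time: at stage [k] the sets where [phi i] is positive, for
    [i < k], and the sets [V i], for [i >= k], still cover. The points [C] missed by all sets but
    the [k]-th form a closed subset of [V k], and Urysohn's lemma gives a bump equal to [1] on [C]
    and [0] off [V k]. *)
Lemma subordinate_bumps (R : realType) (T : topologicalType) (n : nat)
    (V : 'I_n -> set T) (k : nat) :
  normal_space T -> (forall i, open (V i)) -> (forall x, exists i, V i x) ->
  exists phi : 'I_n -> T -> R,
    [/\ forall i, continuous (phi i), forall i x, 0 <= phi i x,
      forall i x, 0 < phi i x -> V i x &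
      forall x, exists i : 'I_n, ((i < k)%N && (0 < phi i x)) \/ ((k <= i)%N /\ V i x)].
Proof.
move=> nT Vo Vc; elim: k => [|k [phi [phic phi0 phiV phik]]].
  exists (fun _ _ => 0); split=> [i|//|i x|x].
  - exact: cst_continuous.
  - by rewrite ltxx.
  - by have [i Vix] := Vc x; exists i; right.
have [nk|kn] := leqP n k.
  exists phi; split=> // x; have [i [/andP[ik px]|[ki _]]] := phik x.
    by exists i; left; rewrite px (ltn_trans ik).
  by have := leq_trans nk ki; rewrite leqNgt ltn_ord.
pose k0 := Ordinal kn.
pose G (i : 'I_n) := if (i < k)%N then phi i @^-1` [set t | t > 0] else
            if (k < i)%N then V i else set0.
have Go i : open (G i).
  rewrite /G; case: ifP => _; last by case: ifP => // _; exact: open0.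
  by have /continuousP := phic i; apply; exact: open_gt.
pose C := ~` \bigcup_i G i.
have Cc : closed C by apply: open_closedC; apply: bigcup_open => i _; exact: Go.
have CV : C `&` ~` V k0 = set0.
  apply/seteqP; split=> // x [xC xV].
  have [i [/andP[ik px]|[ki Vix]]] := phik x.
    by apply: xC; exists i => //; rewrite /G ik.
  move: ki; rewrite leq_eqVlt => /orP[/eqP ki|ki].
    by apply: xV; have -> : k0 = i by apply: val_inj.
  by apply: xC; exists i => //; rewrite /G ltnNge (ltnW ki) /= ki.
have [f [fc fV fC f01]] := @urysohn_ext_itv T R nT (~` V k0) C 0 1
  (open_closedC (Vo k0)) Cc (etrans (setIC _ _) CV) ltr01.
have f0 x : 0 <= f x.
  have : range f (f x) by exists x.
  by move=> /f01 /=; rewrite in_itv /= => /andP[].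
exists (fun i => if i == k0 then f else phi i); split=> /=.
- by move=> i; case: eqP.
- by move=> i x; case: eqP.
- move=> i x; case: eqP => [->|_]; last exact: phiV.
  move=> fx; apply: contrapT => nV; have : (f @` (~` V k0)) (f x) by exists x.
  by move=> /fV /= f00; move: fx; rewrite f00 ltxx.
- move=> x; have [xC|] := pselect (C x).
    exists k0; left; rewrite ltnSn eqxx /=.
    by have -> : f x = 1; [apply: fC; exists x|].
  move=> /contrapT[i _]; rewrite /G; case: ifPn => [ik px|_].
    exists i; left; rewrite (ltn_trans ik) //= ifF //.
    by apply/negbTE/eqP => ik0; move: ik; rewrite ik0 ltnn.
  by case: ifP => // ki Vix; exists i; right.
Qed.

(** The normalized bumps serve as barycentric coordinates; the condition on [K] makes each carrier a
    simplex. *)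
Lemma partition_of_unity (R : realType) (T : topologicalType) (n : nat)
    (K : pred {set 'I_n}) (V : 'I_n -> set T) :
  normal_space T -> (forall i, open (V i)) -> (forall x, exists i, V i x) ->
  (forall x (s : {set 'I_n}), (forall i, i \in s -> V i x) -> K s) ->
  exists f : T -> polyhedron (R := R) K, continuous f /\
    forall x i, 0 < set_val (f x) 0 i -> V i x.
Proof.
move=> nT Vo Vc VK.
have [phi [phic phi0 phiV phin]] := @subordinate_bumps R T n V n nT Vo Vc.
pose S x := \sum_i phi i x.
have S0 x : 0 < S x.
  have [i [/andP[_ px]|[ni _]]] := phin x; last by have := ltn_ord i; rewrite ltnNge ni.
  by rewrite /S (bigD1 i) //= ltr_pwDl // sumr_ge0.
pose t x : 'rV[R]_n := \row_i (phi i x / S x).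
have tV x i : 0 < t x 0 i -> V i x.
  by rewrite mxE pmulr_lgt0 ?invr_gt0 //; exact: phiV.
have tP x : polyhedron K (t x).
  split=> [i||]; first by rewrite mxE divr_ge0 // ltW.
    under eq_bigr do rewrite mxE.
    by rewrite -mulr_suml -/(S x) divff // gt_eqF // S0.
  by apply: (VK x) => i; rewrite inE; exact: tV.
exists (fun x => in_sub (tP x)); split; last by move=> x i; exact: tV.
apply: continuous_into_polyhedron => i x.
have -> : (fun w => set_val (in_sub (tP w)) 0 i) = fun w => phi i w / S w.
  by apply/funext => w; rewrite mxE.
have Sc : continuous S by exact: continuous_sum.
have Sx : S x != 0 by rewrite gt_eqF // S0.
exact: (continuous_div (phic i x) (Sc x) Sx).
Qed.

(** The maps [h] and [h'] exhibit [Y] as dominated by [Z], whose normality supplies the partition of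
    unity. *)
Lemma nerve_equiv (R : realType) (Y : topologicalType) (Z : CWcomplex R) (n : nat)
    (U : 'I_n -> set Y) (h : Z -> Y) (h' : Y -> Z) :
  continuous h -> continuous h' -> homotopic R (h \o h') idfun ->
  (forall i, open (U i)) -> (forall y, exists i, U i y) ->
  (forall s : {set 'I_n}, s != finset.set0 -> meet_family U s !=set0 ->
     contractible_set R (meet_family U s)) ->
  homotopy_equiv R (polyhedron (R := R) (nerve U)) Y.
Proof.
move=> hc h'c hh' Uo Uc ctr.
have moo s := @meet_family_open Y n U Uo s.
have /choice[c cP] : forall s, exists c : Y * R -> Y, s != finset.set0 ->
    contraction (meet_family U s) c.
  move=> s; have [[sN Us]|h0] := pselect (s != finset.set0 /\ meet_family U s !=set0).
    by have [c cP] := contractible_contraction (moo s) (ctr s sN Us); exists c.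
  (* Over an empty intersection the contraction property is vacuous and any map will do. *)
  by exists fst => sN y ys; exfalso; apply: h0; split=> //; exists y.
have [g [gc gU gh]] := nerve_map_exists Uo cP.
pose P := polyhedron (R := R) (nerve U).
have Kc := @nerve_complex Y n U.
have VK (T : Type) (u : T -> Y) x (s : {set 'I_n}) :
    (forall i, i \in s -> U i (u x)) -> nerve U s.
  by move=> sU; apply/asboolP; exists (u x).
have pull (T : topologicalType) (u : T -> Y) : normal_space T -> continuous u ->
    exists f : T -> P, continuous f /\ forall x i, 0 < set_val (f x) 0 i -> U i (u x).
  move=> nT uc; apply: (@partition_of_unity R T n (nerve U) (fun i => u @^-1` U i)) => //.
  - by move=> i; have /continuousP := uc; apply.
  - by move=> x; exact: Uc.
  - by move=> x s; exact: (VK T u x s).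
have [f [fc fU]] := pull Z h (@cw_normal R Z) hc.
pose F := f \o h'; have Fc : continuous F by exact: (continuousT_comp h'c fc).
have gF : homotopic R (g \o F) idfun.
  apply: homotopic_trans hh'; apply: homotopic_sym.
  exact: (homotopic_compr h'c (gh Z h f hc fc fU)).
exists g, F; split => //.
have Pn : normal_space P by exact: (@pseudometric_normal R).
have supU (T : Type) (u : T -> Y) (a b : T -> P) :
    (forall x i, 0 < set_val (a x) 0 i -> U i (u x)) ->
    (forall x i, 0 < set_val (b x) 0 i -> U i (u x)) ->
    forall x, nerve U (supp (set_val (a x)) :|: supp (set_val (b x))).
  by move=> aU bU x; apply: (VK T u x) => i; rewrite !inE => /orP[/aU|/bU].
(* The carrier of [psi x] lies in that of [x], and [g x] lies in [U i] for each of its vertices [i];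
   hence [psi] is contiguous both to the identity and to every lifting of [g]. *)
have [psi [psic psiU]] : exists psi : P -> P, continuous psi /\
    forall x i, 0 < set_val (psi x) 0 i -> U i (g x) /\ 0 < set_val x 0 i.
  apply: (@partition_of_unity R P n (nerve U) (fun i x => U i (g x) /\ 0 < set_val x 0 i)) => //.
  - move=> i; apply: openI.
      by have /continuousP go := gc; exact: (go (U i) (Uo i)).
    have cc : continuous (fun x : P => set_val x 0 i).
      by apply: polyhedron_coord_continuous => x.
    by have /continuousP co := cc; exact: (co _ (@open_gt R 0)).
  - by move=> x; have [i [xi gi]] := gU x; exists i.
  - by move=> x s sU; apply: (VK P g x) => i /sU[].
(* [F \o g] and [psi] are both liftings of maps homotopic to [g]; the homotopy
   is lifted by a partition of unity on the cylinder. *)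
have /homotopicP[H [Hc H0 H1]] := homotopic_compr gc hh'.
have [Psi [Psic PsiU]] : exists f : P * R -> P, continuous f /\
    forall x i, 0 < set_val (f x) 0 i -> U i (H x).
  apply: pull Hc; exact: (@pseudometric_normal R (P * R)%type).
have at_t (t : R) : continuous (fun x : P => Psi (x, t)).
  have tc : continuous (fun x : P => (x, t)).
    by apply: (@continuous_pair _ _ _ id (fun=> t)) => x; [exact: cvg_id|exact: cst_continuous].
  exact: (continuousT_comp tc Psic).
(* The chain runs from [F \o g] through the two ends of [Psi] and [psi] to the identity; every link
   is linear except the one along the cylinder. *)
apply: (@homotopic_trans _ _ _ _ (fun x : P => Psi (x, 0))).
  apply: (linear_homotopy Kc) => //; first exact: (continuousT_comp gc Fc).
  apply: (supU P (h \o h' \o g)) => x i; first exact: fU.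
  by move=> /PsiU; rewrite H0.
apply: (@homotopic_trans _ _ _ _ (fun x : P => Psi (x, 1))).
  apply/homotopicP; exists (Psi \o (fun p : P * R => (p.1, clamp p.2))); split.
  - exact: (continuousT_comp (@clamp_snd_continuous R P) Psic).
  - by move=> x t t0 /=; rewrite clamp_le0.
  - by move=> x t t0 /=; rewrite clamp_ge1.
apply: (@homotopic_trans _ _ _ _ psi).
  apply: (linear_homotopy Kc) => //.
  by apply: (supU P g) => x i; [move=> /PsiU; rewrite H1|case/psiU].
apply: (linear_homotopy Kc) => //; first by move=> x; exact: cvg_id.
move=> x; have [_ _ Kx] := polyhedronP x; apply: Kc Kx.
by apply/fintype.subsetP => i; rewrite !inE => /orP[/psiU[]|].
Qed.

(** * The cell structure of a polyhedron *)

Section Simplex.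
Variables (R : realType) (n : nat) (s : {set 'I_n}).
Let k := #|s|.-1.
Implicit Types v : 'rV[R]_k.

(* A linear isomorphism from [R^k] onto the vectors of [R^n] that are supported
   on [s] and have coordinate sum 0. *)
Definition spread_nat v (r : nat) : R :=
  if insub r is Some j then v 0 j else - \sum_j v 0 j.

Definition spread v (i : 'I_n) : R :=
  if i \in s then spread_nat v (index i (enum s)) else 0.

Definition sqnorm v : R := \sum_j v 0 j ^+ 2.

(** The gauge, with respect to the barycenter, of the simplex of vectors with sum 0 and coordinates
    at least [-1]. *)
Definition depth v : R := \big[Order.max/0]_(i in s) - spread v i.

Lemma spread_out v i : i \notin s -> spread v i = 0.
Proof. by rewrite /spread => /negbTE ->. Qed.

Lemma sum_index (i0 : 'I_n) (F : 'I_n -> R) :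
  \sum_(i in s) F i = \sum_(0 <= r < #|s|) F (nth i0 (enum s) r).
Proof. by rewrite -big_enum /= (big_nth i0) -cardE. Qed.

Lemma spread_continuous i : continuous (spread^~ i).
Proof.
have [is_|is_] := boolP (i \in s); last first.
  have -> : spread^~ i = fun=> 0 by apply/funext => v; exact: spread_out.
  exact: cst_continuous.
have -> : spread^~ i = spread_nat^~ (index i (enum s)).
  by apply/funext => v; rewrite /spread is_.
rewrite /spread_nat; case: insub => [j|]; first exact: coord_continuous.
have Sc : continuous (fun v : 'rV[R]_k => \sum_j v 0 j).
  by apply: continuous_sum => j; exact: coord_continuous.
by move=> v; apply: continuousN; exact: Sc.
Qed.

Lemma spreadZ (a : R) v i : spread (a *: v) i = a * spread v i.
Proof.
rewrite /spread; case: ifP => _; last by rewrite mulr0.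
rewrite /spread_nat; case: (insub _) => [j|]; first by rewrite mxE.
by rewrite mulrN mulr_sumr; congr (- _); apply: eq_bigr => j _; rewrite mxE.
Qed.

Lemma spread0 i : spread 0 i = 0.
Proof. by rewrite -(scale0r (0 : 'rV[R]_k)) spreadZ mul0r. Qed.

Lemma sqnorm0 : sqnorm 0 = 0.
Proof. by rewrite /sqnorm big1 // => j _; rewrite mxE expr0n. Qed.

Hypothesis sN : s != finset.set0.

Let cards : #|s| = k.+1.
Proof. by rewrite /k prednK // card_gt0. Qed.

Let i0 : 'I_n := enum_val (cast_ord (esym cards) ord0).

Lemma spread_nth v r : (r <= k)%N -> spread v (nth i0 (enum s) r) = spread_nat v r.
Proof.
move=> rk; have rs : (r < size (enum s))%N by rewrite -cardE cards.
rewrite /spread -mem_enum mem_nth // index_uniq //; exact: enum_uniq.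
Qed.

Lemma spread_nat_lt v (j : 'I_k) : spread_nat v j = v 0 j.
Proof. by rewrite /spread_nat valK. Qed.

Lemma spread_nat_last v : spread_nat v k = - \sum_j v 0 j.
Proof. by rewrite /spread_nat insubF // ltnn. Qed.

Lemma sum_spread v : \sum_(i in s) spread v i = 0.
Proof.
rewrite (sum_index i0) cards big_nat_recr //= spread_nth // spread_nat_last.
rewrite big_mkord (eq_bigr (fun j => v 0 j)) ?subrr // => j _.
by rewrite spread_nth ?spread_nat_lt // ltnW.
Qed.

Lemma spread_inj v v' : (forall i, i \in s -> spread v i = spread v' i) -> v = v'.
Proof.
move=> vv'; apply/rowP => j; have jk := ltnW (ltn_ord j).
rewrite -!spread_nat_lt -!spread_nth //; apply: vv'.
by rewrite -mem_enum mem_nth // -cardE cards ltnS.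
Qed.

Lemma spread_surj (w : 'I_n -> R) : \sum_(i in s) w i = 0 ->
  exists v, forall i, i \in s -> spread v i = w i.
Proof.
move=> w0; exists (\row_j w (nth i0 (enum s) j)) => i is_.
have ie : i \in enum s by rewrite mem_enum.
have : (index i (enum s) <= k)%N by rewrite -ltnS -cards cardE index_mem.
rewrite leq_eqVlt /spread is_ => /orP[/eqP ik|ik].
  have wk : nth i0 (enum s) k = i by rewrite -ik nth_index.
  move: w0; rewrite (sum_index i0) cards big_nat_recr //= big_mkord wk => /eqP.
  rewrite addr_eq0 => /eqP w0; rewrite ik spread_nat_last.
  by rewrite (eq_bigr (fun j : 'I_k => w (nth i0 (enum s) j))) => [|j _]; rewrite ?mxE // w0 opprK.
by rewrite (spread_nat_lt _ (Ordinal ik)) mxE /= nth_index.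
Qed.

Lemma depth_ge0 v : 0 <= depth v.
Proof. exact: bigmax_ge_id. Qed.

Lemma spread_ge v i : i \in s -> - depth v <= spread v i.
Proof. by move=> is_; rewrite lerNl; exact: (le_bigmax_cond _ (fun i => - spread v i)). Qed.

(** The coordinate is minus the sum of the other ones, each at least [- depth v]. *)
Lemma spread_le v i : i \in s -> spread v i <= #|s|%:R * depth v.
Proof.
move=> is_; have := sum_spread v; rewrite (bigD1 i) //= => /eqP; rewrite addr_eq0 => /eqP ->.
rewrite -sumrN; apply: (@le_trans _ _ (\sum_(j in s | j != i) depth v)).
  by apply: ler_sum => j /andP[js _]; rewrite lerNl; exact: spread_ge.
rewrite sumr_const -[leLHS]mulr_natl ler_wpM2r ?depth_ge0 // ler_nat.
by apply: subset_leq_card; apply/fintype.subsetP => j /andP[].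
Qed.

Lemma norm_spread v i : `|spread v i| <= #|s|%:R * depth v.
Proof.
have [is_|is_] := boolP (i \in s); last first.
  by rewrite spread_out // normr0 mulr_ge0 // depth_ge0.
rewrite ler_norml spread_le // andbT; apply: le_trans (spread_ge v is_).
by rewrite lerN2 ler_peMl ?depth_ge0 // cards ler1n.
Qed.

Lemma depth0 v : depth v = 0 -> v = 0.
Proof.
move=> d0; apply: spread_inj => i is_; rewrite spread0.
by apply/eqP; rewrite -normr_le0 (le_trans (norm_spread v i)) // d0 mulr0.
Qed.

Lemma depth_attained v : exists2 i, i \in s & spread v i = - depth v.
Proof.
have is0 : i0 \in s by exact: enum_valP.
have [d0|d0] := eqVneq (depth v) 0.
  by exists i0 => //; rewrite d0 oppr0 (depth0 d0) spread0.
apply: contrapT => h; suff : depth v < depth v by rewrite ltxx.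
apply/bigmax_ltP; split=> [|i is_]; first by rewrite lt_neqAle eq_sym d0 depth_ge0.
rewrite lt_neqAle (le_bigmax_cond _ (fun i => - spread v i)) // andbT.
by apply/eqP => vi; apply: h; exists i => //; rewrite -vi opprK.
Qed.

Lemma depth_gt0 v : v != 0 -> 0 < depth v.
Proof.
move=> v0; rewrite lt_neqAle depth_ge0 andbT eq_sym.
by apply: contra v0 => /eqP/depth0 ->.
Qed.

Lemma depthZ (a : R) v : 0 <= a -> depth (a *: v) = a * depth v.
Proof.
move=> a0; apply/eqP; rewrite eq_le; apply/andP; split.
  apply/bigmax_leP; split=> [|i is_]; first by rewrite mulr_ge0 // depth_ge0.
  by rewrite spreadZ -mulrN ler_wpM2l // lerNl spread_ge.
have [i is_ vi] := depth_attained v.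
by rewrite -[depth v]opprK -vi mulrN -spreadZ lerNl spread_ge.
Qed.

Lemma sqnorm_ge0 v : 0 <= sqnorm v.
Proof. by apply: sumr_ge0 => j _; exact: sqr_ge0. Qed.

Lemma sqnormZ (a : R) v : sqnorm (a *: v) = a ^+ 2 * sqnorm v.
Proof. by rewrite /sqnorm mulr_sumr; apply: eq_bigr => j _; rewrite mxE exprMn. Qed.

Lemma sqnorm_eq0 v : sqnorm v = 0 -> v = 0.
Proof.
move=> /eqP; rewrite psumr_eq0 => [/allP h|j _]; last exact: sqr_ge0.
by apply/rowP => j; rewrite mxE; have := h j (mem_index_enum _); rewrite sqrf_eq0 => /eqP.
Qed.

(* The factor makes [- sqnorm v] the least coordinate of [radial v], so that the unit
   disk is mapped onto the vectors with coordinates at least [-1]; for [v = 0] it is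
   [0 / 0 = 0]. *)
Definition radial v (i : 'I_n) : R := sqnorm v / depth v * spread v i.

Lemma norm_radial v i : `|radial v i| <= #|s|%:R * sqnorm v.
Proof.
have [->|v0] := eqVneq v 0.
  by rewrite /radial spread0 mulr0 normr0 mulr_ge0 // sqnorm_ge0.
have d0 := depth_gt0 v0.
rewrite /radial normrM ger0_norm ?divr_ge0 ?sqnorm_ge0 ?depth_ge0 //.
have -> : #|s|%:R * sqnorm v = sqnorm v / depth v * (#|s|%:R * depth v).
  by field; rewrite gt_eqF.
by rewrite ler_wpM2l ?divr_ge0 ?sqnorm_ge0 ?depth_ge0 // norm_spread.
Qed.

Lemma sqnorm_continuous : continuous sqnorm.
Proof.
apply: continuous_sum => j v; exact: (continuous_mul (@coord_continuous R 1 k 0 j v)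
  (@coord_continuous R 1 k 0 j v)).
Qed.

(** At [0], where the quotient degenerates, [norm_radial] squeezes the coordinate between multiples
    of [sqnorm]. *)
Lemma radial_continuous i : continuous (radial^~ i).
Proof.
move=> v; have [->|v0] := eqVneq v 0; last first.
  have dc : continuous depth.
    have c j : continuous (fun v => - spread v j).
      by move=> u; apply: continuousN; exact: spread_continuous.
    exact: (continuous_bigmax c).
  have d0 : depth v != 0 by rewrite gt_eqF // depth_gt0.
  exact: (continuous_mul (continuous_div (@sqnorm_continuous v) (dc v) d0)
            (@spread_continuous i v)).
have r0 : radial 0 i = 0 by rewrite /radial spread0 mulr0.
have uc := continuous_mul (@continuous_cst R _ (0 : 'rV[R]_k) #|s|%:R) (@sqnorm_continuous 0).
have lc := continuous_sub (@continuous_cst R _ (0 : 'rV[R]_k) 0) uc.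
rewrite /prop_for /continuous_at r0.
rewrite /prop_for /continuous_at sqnorm0 mulr0 subr0 in lc.
rewrite /prop_for /continuous_at sqnorm0 mulr0 in uc.
apply: (@squeeze_cvgr _ _ _ _ _ _ _ _ 0 lc uc).
by apply: nearW => u; rewrite sub0r -ler_norml norm_radial.
Qed.
End Simplex.

Section Cell.
Variables (R : realType) (n : nat) (s : {set 'I_n}).
Hypothesis sN : s != finset.set0.
Let k := #|s|.-1.
Implicit Types v : 'rV[R]_k.

Let cards0 : (#|s|%:R : R) != 0.
Proof. by rewrite pnatr_eq0 cards_eq0. Qed.

Let cards_gt0 : 0 < (#|s|%:R : R).
Proof. by rewrite ltr0n card_gt0. Qed.

Lemma radial0 i : radial (0 : 'rV[R]_k) i = 0.
Proof. by rewrite /radial spread0 mulr0. Qed.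

Lemma radial_ge v i : i \in s -> - sqnorm v <= radial v i.
Proof.
move=> is_; have [->|v0] := eqVneq v 0; first by rewrite radial0 sqnorm0 oppr0.
have d0 := depth_gt0 sN v0.
have -> : - sqnorm v = sqnorm v / depth v * - depth v by field; rewrite gt_eqF.
by rewrite /radial ler_wpM2l ?divr_ge0 ?sqnorm_ge0 ?depth_ge0 // spread_ge.
Qed.

Lemma radial_attained v : exists2 i, i \in s & radial v i = - sqnorm v.
Proof.
have [i is_ vi] := depth_attained sN v; exists i => //.
have [v0|v0] := eqVneq v 0.
  by rewrite v0 radial0 sqnorm0 oppr0.
have d0 := depth_gt0 sN v0.
by rewrite /radial vi; field; rewrite gt_eqF.
Qed.

Lemma sum_radial v : \sum_(i in s) radial v i = 0.
Proof. by rewrite -mulr_sumr sum_spread // mulr0. Qed.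

(** The least coordinate recovers [sqnorm]. Then [v] and [v'] are positively proportional and have
    the same norm. *)
Lemma radial_inj v v' : (forall i, i \in s -> radial v i = radial v' i) -> v = v'.
Proof.
move=> vv'; have qq : sqnorm v = sqnorm v'.
  have [i is_ vi] := radial_attained v; have [j js vj] := radial_attained v'.
  apply/eqP; rewrite eq_le -lerN2 -vi vv' // radial_ge //=.
  by rewrite -lerN2 -vj -vv' // radial_ge.
have [v0|v0] := eqVneq v 0.
  apply/esym; rewrite v0; apply: sqnorm_eq0.
  by rewrite -qq v0 sqnorm0.
have v'0 : v' != 0.
  apply: contra_neq v0 => v'0; apply: sqnorm_eq0.
  by rewrite qq v'0 sqnorm0.
have d0 := depth_gt0 sN v0; have d'0 := depth_gt0 sN v'0.
have q0 : sqnorm v != 0 by apply: contra_neq v0; exact: sqnorm_eq0.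
have E : depth v' *: v = depth v *: v'.
  apply: (spread_inj sN) => i is_; rewrite !spreadZ.
  have := vv' i is_; rewrite /radial -qq -!mulrA => /(mulfI q0).
  move=> /(congr1 (fun t => depth v * depth v' * t)).
  rewrite !mulrA mulfK ?gt_eqF // => h.
  by move: h; rewrite [depth v * depth v' / _]mulrAC divff ?gt_eqF // mul1r => ->.
have dd : depth v = depth v'.
  have := congr1 (@sqnorm R n s) E; rewrite !sqnormZ -qq => /(mulIf q0)/eqP.
  by rewrite eqrXn2 ?ltW // => /eqP.
by move: E; rewrite dd; apply: scalerI; rewrite gt_eqF.
Qed.

Lemma radial_surj (w : 'I_n -> R) : \sum_(i in s) w i = 0 ->
  (forall i, i \in s -> - 1 < w i) ->
  exists v, sqnorm v < 1 /\ forall i, i \in s -> radial v i = w i.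
Proof.
move=> w0 w1; have [v vw] := spread_surj sN w0.
have [v0|v0] := eqVneq v 0.
  exists v; rewrite v0 sqnorm0 ltr01; split=> // i is_.
  by rewrite radial0 -vw // v0 spread0.
have d0 := depth_gt0 sN v0.
have q0 : 0 < sqnorm v.
  by rewrite lt_neqAle sqnorm_ge0 andbT eq_sym; apply: contra_neq v0; exact: sqnorm_eq0.
(* Scaling [v] by [a] turns [radial] into [a ^+ 2 * sqnorm v / depth v] times [spread v]; this [a]
   makes the factor [1], and the new [sqnorm] is [depth v], which is less than [1]. *)
pose a := Num.sqrt (depth v / sqnorm v).
have a0 : 0 < a by rewrite sqrtr_gt0 divr_gt0.
have a2 : a ^+ 2 = depth v / sqnorm v by rewrite sqr_sqrtr // divr_ge0 ?ltW.
exists (a *: v); split.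
  have [i is_ vi] := depth_attained sN v.
  by rewrite sqnormZ a2 divfK ?gt_eqF // -ltrN2 -vi vw // w1.
move=> i is_; rewrite /radial sqnormZ depthZ ?ltW // spreadZ vw // a2.
by field; rewrite !gt_eqF.
Qed.

(** The affine map [w -> (1 + w) / #|s|] sends [0] to the barycenter and the condition [w i = -1] to
    the facet opposite to [i]. So open disk and sphere go to interior and boundary of the
    simplex. *)
Definition simplex_point v : 'rV[R]_n :=
  \row_i (if i \in s then (1 + radial v i) / #|s|%:R else 0).

Lemma sum_simplex_point v : \sum_i simplex_point v 0 i = 1.
Proof.
rewrite (bigID (mem s)) /= [X in _ + X]big1 => [|i is_]; last first.
  by rewrite mxE (negbTE is_).
rewrite addr0 (eq_bigr (fun i => (1 + radial v i) / #|s|%:R)) => [|i is_]; last first.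
  by rewrite mxE is_.
by rewrite -mulr_suml big_split /= sum_radial addr0 sumr_const divff.
Qed.

Lemma supp_open_disk v : sqnorm v < 1 -> supp (simplex_point v) = s.
Proof.
move=> v1; apply/setP => i; rewrite inE mxE; case: ifP => is_; last by rewrite ltxx.
by rewrite divr_gt0 // -ltrBlDl sub0r (lt_le_trans _ (radial_ge v is_)) // ltrN2.
Qed.

Lemma simplex_point_ge0 v : sqnorm v <= 1 -> forall i, 0 <= simplex_point v 0 i.
Proof.
move=> v1 i; rewrite mxE; case: ifP => // is_.
by rewrite divr_ge0 ?ler0n // -lerBlDl sub0r (le_trans _ (radial_ge v is_)) // lerN2.
Qed.

Lemma supp_disk v : supp (simplex_point v) \subset s.
Proof.
by apply/fintype.subsetP => i; rewrite inE mxE; case: ifP => //; rewrite ltxx.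
Qed.

Lemma supp_sphere v : sqnorm v = 1 -> supp (simplex_point v) \proper s.
Proof.
move=> v1; rewrite properE supp_disk /=; apply/fintype.subsetPn.
have [i is_ vi] := radial_attained v; exists i => //.
by rewrite inE mxE is_ vi v1 subrr mul0r ltxx.
Qed.

Lemma simplex_point_inj : injective simplex_point.
Proof.
move=> v v' vv'; apply: radial_inj => i is_.
have := congr1 (fun t : 'rV[R]_n => t 0 i) vv'; rewrite !mxE is_ => /(mulIf _).
by rewrite invr_eq0 => /(_ cards0)/addrI.
Qed.

Lemma simplex_point_surj (t : 'rV[R]_n) : (forall i, 0 <= t 0 i) ->
  \sum_i t 0 i = 1 -> supp t = s -> exists v, sqnorm v < 1 /\ simplex_point v = t.
Proof.
move=> t0 t1 ts.
have tout i : i \notin s -> t 0 i = 0.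
  by rewrite -ts inE -leNgt => ti; apply/eqP; rewrite eq_le ti t0.
have [||v [v1 vt]] := @radial_surj (fun i => #|s|%:R * t 0 i - 1).
- rewrite big_split /= -mulr_sumr sumrN sumr_const.
  move: t1; rewrite (bigID (mem s)) /= [X in _ + X]big1 => [|i /tout //].
  by rewrite addr0 => ->; rewrite mulr1 subrr.
- by move=> i; rewrite -{1}ts inE => ti; rewrite ltrDr mulr_gt0.
exists v; split=> //; apply/rowP => i; rewrite mxE; case: ifPn => [is_|/tout -> //].
by rewrite vt // addrC subrK mulrAC divff ?mul1r.
Qed.

Lemma simplex_point_continuous : continuous simplex_point.
Proof.
move=> v; apply: continuous_into_row => i.
have [is_|is_] := boolP (i \in s); last first.
  have -> : (fun u => simplex_point u 0 i) = fun=> 0.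
    by apply/funext => u; rewrite mxE (negbTE is_).
  exact: cst_continuous.
have -> : (fun u => simplex_point u 0 i) = fun u => (1 + radial u i) / #|s|%:R.
  by apply/funext => u; rewrite mxE is_.
have c1 := @continuous_cst R _ v 1; have cs := @continuous_cst R _ v #|s|%:R.
exact: (continuous_div (continuous_add c1 (@radial_continuous R n s sN i v)) cs cards0).
Qed.

End Cell.

(** * Simplices as cells *)

Section PolyhedronCW.
Variables (R : realType) (n : nat) (K : pred {set 'I_n}).
Hypothesis Kc : complex K.
Let P := polyhedron (R := R) K.

Local Notation simplices := {s : {set 'I_n} | K s && (s != finset.set0)}.

Definition simplex_dim (s : simplices) : nat := #|val s|.-1.

Lemma simplex_neq0 (s : simplices) : val s != finset.set0.
Proof. by case/andP: (valP s). Qed.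

Lemma simplex_in (s : simplices) : K (val s).
Proof. by case/andP: (valP s). Qed.

(* Makes the characteristic maps total: points outside the disk are sent to the center,
   since [simplex_point] may leave the polyhedron there. *)
Definition disk_clip (k : nat) (v : 'rV[R]_k) : 'rV[R]_k :=
  if `[< disk v >] then v else 0.

Lemma disk_clipP (k : nat) (v : 'rV[R]_k) : disk (disk_clip v).
Proof.
rewrite /disk_clip; case: asboolP => // _; rewrite /disk /= big1 ?ler01 // => i _.
by rewrite mxE expr0n.
Qed.

Lemma disk_clip_id (k : nat) (v : 'rV[R]_k) : disk v -> disk_clip v = v.
Proof. by move=> vD; rewrite /disk_clip asboolT. Qed.

Lemma simplex_point_polyhedron (s : simplices) (v : 'rV[R]_(simplex_dim s)) :
  P (simplex_point (disk_clip v)).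
Proof.
have vD : sqnorm (disk_clip v) <= 1 by exact: disk_clipP.
split; [exact: (simplex_point_ge0 (simplex_neq0 s) vD)|exact: sum_simplex_point (simplex_neq0 s) _|].
exact: Kc (supp_disk _) (simplex_in s).
Qed.

Definition simplex_char (s : simplices) (v : 'rV[R]_(simplex_dim s)) : P :=
  in_sub (simplex_point_polyhedron v).

Lemma simplex_charE s (v : 'rV[R]_(simplex_dim s)) :
  disk v -> set_val (simplex_char v) = simplex_point v.
Proof.
move=> vD; have -> : set_val (simplex_char v) = simplex_point (disk_clip v) by [].
by rewrite disk_clip_id.
Qed.

Lemma simplex_char_continuous s :
  {within @disk R (simplex_dim s), continuous (@simplex_char s)}.
Proof.
apply/subspace_sigL_continuousP; apply: continuous_into_sub.
have -> : set_val \o sigL (@disk R (simplex_dim s)) (@simplex_char s) =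
    @simplex_point R n (val s) \o set_val.
  by apply/funext => v; apply: simplex_charE; exact: set_valP.
apply: (continuousT_comp (@set_val_continuous _ _)).
exact: (simplex_point_continuous (simplex_neq0 s)).
Qed.

(** With this description, covering, disjointness and the boundary condition become statements about
    carriers. *)
Lemma simplex_open_cell s :
  @simplex_char s @` @open_disk R (simplex_dim s) = [set p | supp (set_val p) = val s].
Proof.
apply/seteqP; split=> [_ [v vD <-]|p ps].
  rewrite /= simplex_charE; last exact: open_disk_disk.
  exact: (supp_open_disk (simplex_neq0 s) vD).
have [p0 p1 _] := polyhedronP p.
have [v [v1 vp]] := simplex_point_surj (simplex_neq0 s) p0 p1 ps.
exists v => //; apply: val_inj; apply: etrans vp; apply: simplex_charE; exact: ltW.
Qed.

Lemma polyhedron_supp_simplex (p : P) :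
  exists s : simplices, supp (set_val p) = val s.
Proof.
have [_ _ Kp] := polyhedronP p.
have pN := polyhedron_supp_neq0 (set_valP p).
have h : K (supp (set_val p)) && (supp (set_val p) != finset.set0) by rewrite Kp.
by exists (exist (fun s : {set 'I_n} => K s && (s != finset.set0)) _ h).
Qed.

Lemma polyhedron_hausdorff : hausdorff_space P.
Proof.
rewrite open_hausdorff => p q pq.
have : set_val p != set_val q by apply: contra_neq pq; exact: val_inj.
have := @norm_hausdorff R 'rV[R]_n; rewrite open_hausdorff => h /h[[A B] /= [pA qB] [Ao Bo AB]].
exists (set_val @^-1` A, set_val @^-1` B); first by rewrite !inE in pA qB *.
have /continuousP c := @set_val_continuous _ P.
split; [exact: c|exact: c|].
by apply/eqP/seteqP; split=> // x [Ax Bx]; have : (A `&` B) (set_val x) by []; rewrite (eqP AB).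
Qed.

Lemma simplex_injective s : set_inj (@open_disk R (simplex_dim s)) (@simplex_char s).
Proof.
move=> v v'; rewrite !inE => /open_disk_disk vD /open_disk_disk v'D.
move=> /(congr1 set_val); rewrite !simplex_charE //.
exact: (simplex_point_inj (simplex_neq0 s)).
Qed.

Lemma simplex_cover :
  \bigcup_s (@simplex_char s @` @open_disk R (simplex_dim s)) = [set: P].
Proof.
apply/seteqP; split=> // p _; have [s ps] := polyhedron_supp_simplex p.
by exists s => //; rewrite simplex_open_cell.
Qed.

Lemma simplex_disjoint :
  trivIset [set: simplices] (fun s => @simplex_char s @` @open_disk R (simplex_dim s)).
Proof.
move=> s t _ _ [p []]; rewrite !simplex_open_cell /= => ps pt.
by apply: val_inj; exact: (etrans (esym ps) pt).
Qed.

Lemma simplex_boundary s : exists J : set simplices,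
  [/\ finite_set J, forall j, J j -> (simplex_dim j < simplex_dim s)%N &
    @simplex_char s @` @sphere R (simplex_dim s) `<=`
      \bigcup_(j in J) (@simplex_char j @` @open_disk R (simplex_dim j))].
Proof.
exists [set j : simplices | val j \proper val s]; split.
- exact: finite_finset.
- move=> j /= /proper_card js; rewrite /simplex_dim.
  have : (0 < #|val j|)%N by rewrite card_gt0 simplex_neq0.
  by case: #|val j| js => // m; case: #|val s|.
- move=> _ [v vS <-]; have [j pj] := polyhedron_supp_simplex (simplex_char v).
  exists j; last by rewrite simplex_open_cell.
  rewrite /= -pj simplex_charE; last exact: sphere_disk.
  exact: (supp_sphere (simplex_neq0 s) vS).
Qed.

(** There are finitely many cells, so [C] is a finite union of compact images. *)
Lemma simplex_weak (C : set P) :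
  (forall s, closed (@disk R (simplex_dim s) `&` @simplex_char s @^-1` C)) -> closed C.
Proof.
move=> Cc.
have -> : C = \bigcup_s (@simplex_char s @` (@disk R (simplex_dim s) `&` @simplex_char s @^-1` C)).
  apply/seteqP; split=> [p pC|p [s _ [v [_ vC] <-]] //].
  have [s ps] := polyhedron_supp_simplex p.
  have [v vD vp] : (@simplex_char s @` @open_disk R (simplex_dim s)) p.
    by rewrite simplex_open_cell.
  exists s => //; exists v => //; split; first exact: open_disk_disk.
  by rewrite /preimage /= vp.
apply: closed_bigcup => [|s _]; first exact: finite_finset.
apply: compact_closed; first exact: polyhedron_hausdorff.
apply: continuous_compact.
  by apply: continuous_subspaceW (@simplex_char_continuous s) => v [].
apply: (subclosed_compact (Cc s) (@disk_compact R _)).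
by move=> v [].
Qed.

Definition polyhedron_CW : CWcomplex R :=
  Build_CWcomplex polyhedron_hausdorff simplex_char_continuous simplex_injective
    simplex_cover simplex_disjoint simplex_boundary simplex_weak.

Lemma hdim_polyhedron (X : topologicalType) (d : nat) :
  homotopy_equiv R P X -> (forall s, K s -> #|s| <= d.+1)%N ->
  (hdim R X <= d%:R%:E)%E.
Proof.
move=> PX Kd; apply: (@le_trans _ _ (cw_dim polyhedron_CW)).
  by apply: ereal_inf_lbound; exists polyhedron_CW.
apply: ge_ereal_sup => _ [s _ <-]; rewrite lee_fin ler_nat /= /simplex_dim.
by have := Kd _ (simplex_in s); case: #|_|.
Qed.

End PolyhedronCW.

(** * Lusternik-Schnirelmann category *)

(** The category counts distinct members of a cover, whereas the [A i] may repeat; their number [k]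
    is at most [m]. *)
Lemma lscat_le (R : realType) (X : topologicalType) (m : nat) (A : nat -> set X) :
  (forall i, (i < m)%N -> open (A i)) ->
  (forall i, (i < m)%N -> categorical R (A i)) ->
  (forall x, exists2 i, (i < m)%N & A i x) -> (lscat R X <= m%:R%:E)%E.
Proof.
move=> Ao Acat Ac; pose U := A @` `I_m.
have /finite_setP[k Uk] : finite_set U by apply: finite_image; exact: finite_II.
have km : (k <= m)%N.
  have : (`I_k #<= `I_m)%card by rewrite -(card_le_eql Uk) card_image_le.
  by rewrite card_le_II.
apply: (@le_trans _ _ k%:R%:E); last by rewrite lee_fin ler_nat.
apply: ereal_inf_lbound; exists k => //; exists U; split=> //.
- split=> [_ [i im <-]|]; first exact: Ao.
  apply/seteqP; split=> // x _; have [i im Aix] := Ac x.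
  by exists (A i) => //; exists i.
- by move=> _ [i im <-]; exact: Acat.
Qed.

(** The inclusion is homotopic to the restriction of [g \o f], which factors through the inclusion
    of [A]. *)
Lemma categorical_preimage (R : realType) (X Y : topologicalType) (f : X -> Y)
    (g : Y -> X) (A : set Y) :
  continuous f -> continuous g -> homotopic R (g \o f) idfun ->
  categorical R A -> categorical R (f @^-1` A).
Proof.
move=> fc gc gf [y0 Ay0]; exists (g y0).
pose fA (x : f @^-1` A) : A := @in_sub _ A (f (set_val x)) (set_valP x).
have vc := @set_val_continuous X (f @^-1` A).
have fAc : continuous fA.
  by apply: continuous_into_sub; exact: (continuousT_comp vc fc).
apply: (homotopic_trans (homotopic_sym (homotopic_compr vc gf))).
exact: (homotopic_compr fAc (homotopic_compl gc Ay0)).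
Qed.

(** A path, encoded as a homotopy of constant maps so that reversal and concatenation are those of
    homotopies. *)
Definition joined (R : realType) (X : topologicalType) (p q : X) :=
  homotopic R (cst p : R -> X) (cst q : R -> X).

(** Each point follows the path chosen for its index; near a given point only one path is
    involved. *)
Lemma locally_constant_homotopy (R : realType) (W X : topologicalType) (I : Type)
    (s : W -> I) (phi : I -> X) (q : X) :
  (forall w, \forall v \near w, s v = s w) -> (forall i, joined R (phi i) q) ->
  homotopic R (phi \o s) (cst q).
Proof.
move=> sc phiq.
have /choice[H HP] : forall i, exists H : R * R -> X, [/\ continuous H,
    forall x t, t <= 0 -> H (x, t) = phi i & forall x t, 1 <= t -> H (x, t) = q].
  by move=> i; have /homotopicP := phiq i.
apply/homotopicP; exists (fun p : W * R => H (s p.1) (0, p.2)).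
split=> [[w t]|w t t0|w t t1] /=.
- apply: (@continuous_near_eq _ _ _ (fun p : W * R => H (s w) (0, p.2))).
    have h : \forall p \near (w, t), s p.1 = s w.
      exact: (@cvg_fst _ _ (nbhs w) (nbhs t) _ _ (sc w)).
    by apply: filterS h => p /= ->.
  have c : continuous (fun p : W * R => (0 : R, p.2)).
    apply: (@continuous_pair _ _ _ (fun=> 0) snd) => p; first exact: cst_continuous.
    exact: cvg_snd.
  have [Hc _ _] := HP (s w); exact: (continuousT_comp c Hc).
- by have [_ H0 _] := HP (s w); exact: H0.
- by have [_ _ H1] := HP (s w); exact: H1.
Qed.

Section PolyhedronCategory.
Variables (R : realType) (n : nat) (K : pred {set 'I_n}).
Hypothesis Kc : complex K.
Let P := polyhedron (R := R) K.

Lemma near_supp_subset (p : P) : \forall q \near p, supp (set_val p) \subset supp (set_val q).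
Proof.
have near_i i : \forall q \near p, i \in supp (set_val p) -> i \in supp (set_val q).
  have [ip|ip] := boolP (i \in supp (set_val p)); last first.
    by apply: (@nearW _ (nbhs p) _ (nbhs_filter p)).
  have cc : continuous (fun q : P => set_val q 0 i).
    by apply: polyhedron_coord_continuous => q.
  have h : \forall q \near p, 0 < set_val (q : P) 0 i.
    by apply: (cvgr_gt (set_val p 0 i) (cc p)); move: ip; rewrite inE.
  by apply: (@filterS _ (nbhs p) (nbhs_filter p) _ _ _ h) => q q0 _; rewrite inE.
have near_all := @filter_forall _ _ _ (nbhs p) (nbhs_filter p) near_i.
apply: (@filterS _ (nbhs p) (nbhs_filter p) _ _ _ near_all) => q pq.
by apply/fintype.subsetP => i; exact: pq.
Qed.

Lemma joined_supp (p q : P) :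
  supp (set_val p) \subset supp (set_val q) -> joined R p q.
Proof.
move=> pq; apply: (linear_homotopy Kc); [exact: cst_continuous|exact: cst_continuous|].
by move=> _ /=; have [_ _] := polyhedronP q; apply: Kc; rewrite finset.subUset pq subxx.
Qed.

(** Nearby points have larger carriers, so path classes in the polyhedron are open and closed.
    Connectedness of [X] puts the image of [f] in one class, and the homotopy from [f \o g] to the
    identity joins every point to that image. *)
Lemma polyhedron_joined (X : topologicalType) : connected [set: X] ->
  homotopy_equiv R P X -> forall p q : P, joined R p q.
Proof.
move=> Xc [g [f [gc fc fg gf]]].
pose J (p0 : P) := [set q : P | joined R p0 q].
have Jo p0 : open (J p0).
  rewrite openE => q Jq; rewrite /interior.
  apply: (@filterS _ (nbhs q) (nbhs_filter q) _ _ _ (near_supp_subset q)) => r qr.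
  exact: homotopic_trans Jq (joined_supp qr).
have Jc p0 : closed (J p0).
  rewrite -[J p0]setCK; apply: open_closedC; rewrite openE => q Jq; rewrite /interior.
  apply: (@filterS _ (nbhs q) (nbhs_filter q) _ _ _ (near_supp_subset q)) => r qr Jr.
  by apply: Jq; apply: homotopic_trans Jr (homotopic_sym (joined_supp qr)).
have fgJ q : joined R (f (g q)) q by exact: (homotopic_compr (@cst_continuous R P q) fg).
have X1 (x y : X) : joined R (f x) (f y).
  have : f @^-1` J (f x) = [set: X].
    apply: Xc.
    - by exists x; apply: homotopic_refl; exact: cst_continuous.
    - exists (f @^-1` J (f x)); last by rewrite setTI.
      by have /continuousP fo := fc; exact: fo.
    - exists (f @^-1` J (f x)); last by rewrite setTI.
      by have /continuous_closedP fcl := fc; exact: fcl.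
  by move=> e; have : [set: X] y by []; rewrite -e.
move=> p q; apply: homotopic_trans (fgJ q).
exact: homotopic_trans (homotopic_sym (fgJ p)) (X1 _ _).
Qed.

Lemma vertex_polyhedron (v : 'I_n) : K [set v]%SET -> P (\row_i (i == v)%:R).
Proof.
move=> Kv; split; first by move=> i; rewrite mxE ler0n.
- rewrite (bigD1 v) //= mxE eqxx big1 ?addr0 // => i /negbTE iv.
  by rewrite mxE iv.
- suff -> : supp (\row_i (i == v)%:R : 'rV[R]_n) = [set v]%SET by [].
  by apply/setP => i; rewrite !inE mxE ltr0n; case: (i == v).
Qed.

Lemma exists_vertex (v : 'I_n) : K [set v]%SET ->
  exists e : P, supp (set_val e) = [set v]%SET.
Proof.
move=> Kv; exists (in_sub (vertex_polyhedron Kv)).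
by apply/setP => i; rewrite !inE /= mxE ltr0n; case: (i == v).
Qed.

Lemma categorical_polyhedron (A : set P) (f : A -> P) (q : P) : continuous f ->
  (forall p : A, K (supp (set_val (set_val p)) :|: supp (set_val (f p)))) ->
  homotopic R f (cst q) -> categorical R A.
Proof.
move=> fc fK fq; exists q; apply: homotopic_trans fq.
by apply: (linear_homotopy Kc) => //; exact: set_val_continuous.
Qed.

Definition star (s : {set 'I_n}) : set P :=
  [set p : P | exists2 i, i \in s & 0 < set_val p 0 i].

Lemma star_open s : open (star s).
Proof.
have -> : star s = \bigcup_(i in [set i | i \in s]) [set p : P | 0 < set_val p 0 i].
  by apply/seteqP; split=> p [i] is_ ip; exists i.
apply: bigcup_open => i _.
have cc : continuous (fun q : P => set_val q 0 i).
  by apply: polyhedron_coord_continuous => q.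
by have /continuousP co := cc; exact: (co _ (@open_gt R 0)).
Qed.

(** Restricting the coordinates to [s] and renormalizing moves each point within its carrier into
    the simplex [s], which contracts linearly to a vertex. *)
Lemma star_categorical s : s != finset.set0 -> K s -> categorical R (star s).
Proof.
move=> /finset.set0Pn[v vs] Ks.
have Kv : K [set v]%SET by apply: Kc Ks; rewrite finset.sub1set.
have [e es] := exists_vertex Kv.
pose S (p : P) := \sum_(i in s) set_val p 0 i.
have S0 (p : star s) : 0 < S (set_val p).
  have [i is_ ip] := set_valP p; have [p0 _ _] := polyhedronP (set_val p).
  by rewrite /S (bigD1 i) //= ltr_pwDl // sumr_ge0.
pose t (p : star s) : 'rV[R]_n :=
  \row_i (if i \in s then set_val (set_val p) 0 i / S (set_val p) else 0).
have tS p : supp (t p) \subset s.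
  by apply/fintype.subsetP => i; rewrite inE mxE; case: ifP => //; rewrite ltxx.
have tp p : supp (t p) \subset supp (set_val (set_val p)).
  apply/fintype.subsetP => i; rewrite !inE mxE; case: ifP => _; last by rewrite ltxx.
  by rewrite pmulr_lgt0 // invr_gt0.
have tP p : P (t p).
  have [p0 p1 Kp] := polyhedronP (set_val p); split; last exact: Kc (tp p) Kp.
    by move=> i; rewrite mxE; case: ifP => // _; rewrite divr_ge0 // ltW.
  rewrite (bigID (mem s)) /= [X in _ + X]big1 => [|i /negbTE is_]; last by rewrite mxE is_.
  rewrite addr0 (eq_bigr (fun i => set_val (set_val p) 0 i / S (set_val p))) => [|i is_].
    by rewrite -mulr_suml -/(S _) divff // gt_eqF.
  by rewrite mxE is_.
pose f (p : star s) : P := in_sub (tP p).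
have fc : continuous f.
  apply: continuous_into_polyhedron => i.
  have cc j : continuous (fun q : star s => set_val (set_val q) 0 j).
    by apply: polyhedron_coord_continuous; exact: set_val_continuous.
  have Sc : continuous (fun q : star s => S (set_val q)).
    exact: (continuous_sum (Q := mem s) cc).
  have [is_|is_] := boolP (i \in s).
    have -> : (fun w => set_val (f w) 0 i) = fun w => set_val (set_val w) 0 i / S (set_val w).
      by apply/funext => w; rewrite mxE is_.
    move=> p; have Sp : S (set_val p) != 0 by rewrite gt_eqF.
    exact: (continuous_div (cc i p) (Sc p) Sp).
  have -> : (fun w => set_val (f w) 0 i) = fun=> 0.
    by apply/funext => w; rewrite mxE (negbTE is_).
  exact: cst_continuous.
apply: (@categorical_polyhedron _ f e) => //.
- move=> p; have [_ _ Kp] := polyhedronP (set_val p); apply: Kc Kp.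
  by rewrite finset.subUset subxx; exact: tp.
- apply: (linear_homotopy Kc) => //; first exact: cst_continuous.
  by move=> p; apply: Kc Ks; rewrite finset.subUset es finset.sub1set vs andbT; exact: tS.
Qed.

End PolyhedronCategory.

(** * Disjoint unions of open stars of barycenters *)

Section Layers.
Variables (R : realType) (n : nat) (K : pred {set 'I_n}) (V : {set 'I_n}).
Hypothesis Kc : complex K.
Let P := polyhedron (R := R) K.

(* The vertices of [s] have the largest barycentric coordinates among those of [V];
   these sets are the open stars of the barycenters of the simplices of [V]. *)
Definition dominates (s : {set 'I_n}) (p : P) :=
  s \subset V /\ forall i, i \in s -> 0 < set_val p 0 i /\
    forall j, j \in V :\: s -> set_val p 0 j < set_val p 0 i.

Definition layer (k : nat) : set P := [set p : P | exists s : {set 'I_n}, #|s| = k /\ dominates s p].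

Lemma near_dominates s (p : P) : dominates s p -> \forall q \near p, dominates s q.
Proof.
move=> [sV sp].
have cc i : continuous (fun q : P => set_val q 0 i).
  by apply: polyhedron_coord_continuous => q.
have near_i i : \forall q \near p, i \in s -> 0 < set_val (q : P) 0 i.
  have [/sp[ip _]|_] := boolP (i \in s); last by apply: (@nearW _ (nbhs p) _ (nbhs_filter p)).
  have h : \forall q \near p, 0 < set_val (q : P) 0 i.
    exact: (cvgr_gt (set_val p 0 i) (cc i p)).
  by apply: (@filterS _ (nbhs p) (nbhs_filter p) _ _ _ h).
have near_ij (ij : 'I_n * 'I_n) : \forall q \near p, ij.1 \in s -> ij.2 \in V :\: s ->
    set_val (q : P) 0 ij.2 < set_val q 0 ij.1.
  case: ij => i j /=.
  have [/sp[_ ip]|_] := boolP (i \in s); last by apply: (@nearW _ (nbhs p) _ (nbhs_filter p)).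
  have [/ip jp|_] := boolP (j \in V :\: s); last by apply: (@nearW _ (nbhs p) _ (nbhs_filter p)).
  have h : \forall q \near p, 0 < set_val (q : P) 0 i - set_val q 0 j.
    by apply: (cvgr_gt _ (continuous_sub (cc i p) (cc j p))); rewrite subr_gt0.
  by apply: (@filterS _ (nbhs p) (nbhs_filter p) _ _ _ h) => q; rewrite subr_gt0.
have n1 := @filter_forall _ _ _ (nbhs p) (nbhs_filter p) near_i.
have n2 := @filter_forall _ _ _ (nbhs p) (nbhs_filter p) near_ij.
apply: (@filterS2 _ (nbhs p) (nbhs_filter p) _ _ _ _ n1 n2) => q q1 q2.
by split=> // i is_; split=> [|j js]; [exact: q1|exact: (q2 (i, j))].
Qed.

Lemma layer_open k : open (layer k).
Proof.
rewrite openE => p [s [sk sp]]; rewrite /interior.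
by apply: (@filterS _ (nbhs p) (nbhs_filter p) _ _ _ (near_dominates sp)) => q sq; exists s.
Qed.

(** Distinct sets of equal size each contain an element outside the other, and these two coordinates
    would each be smaller than the other. *)
Lemma dominates_uniq (s t : {set 'I_n}) (p : P) : #|s| = #|t| -> dominates s p -> dominates t p -> s = t.
Proof.
move=> st [sV sp] [tV tp]; apply/eqP; rewrite finset.eqEcard st leqnn andbT.
apply/fintype.subsetP => i is_; apply: contraT => it.
have [j jt js] : exists2 j, j \in t & j \notin s.
  apply/fintype.subsetPn; apply: contra it => ts.
  have /eqP-> // : t == s by rewrite finset.eqEcard ts st leqnn.
have [_ spi] := sp i is_; have [_ tpj] := tp j jt.
have ij : set_val p 0 j < set_val p 0 i.
  by apply: spi; rewrite inE js (fintype.subsetP tV).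
have ji : set_val p 0 i < set_val p 0 j.
  by apply: tpj; rewrite inE it (fintype.subsetP sV).
by have := lt_trans ij ji; rewrite ltxx.
Qed.

Lemma dominates_supp s (p : P) : dominates s p -> s \subset supp (set_val p).
Proof. by move=> [_ sp]; apply/fintype.subsetP => i /sp[ip _]; rewrite inE. Qed.

(** By uniqueness the dominating set is locally constant on the layer. A point slides inside its
    carrier to a vertex [e] of that set, and the vertices then travel to [q] along paths; [0 < k]
    ensures that there is a vertex. *)
Lemma layer_categorical k (q : P) : (0 < k)%N -> (forall p : P, joined R p q) ->
  categorical R (layer k).
Proof.
move=> k0 pq.
have /choice[s sP] : forall p : layer k, exists s : {set 'I_n}, #|s| = k /\ dominates s (set_val p).
  by move=> p; exact: (set_valP p).
have /choice[e eP] : forall t : {set 'I_n}, exists e : P, K t -> t != finset.set0 ->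
    supp (set_val e) \subset t.
  move=> t; have [[Kt /finset.set0Pn[v vt]]|h] := pselect (K t /\ t != finset.set0).
    have Kv : K [set v]%SET by apply: Kc Kt; rewrite finset.sub1set.
    by have [e es] := exists_vertex R Kv; exists e => _ _; rewrite es finset.sub1set.
  by exists q => Kt t0; exfalso; exact: h.
have sloc (p : layer k) : \forall r \near p, s r = s p.
  have [pk sp] := sP p.
  have h : \forall r \near p, dominates (s p) (set_val (r : layer k)).
    exact: (@set_val_continuous _ _ p _ (near_dominates sp)).
  apply: (@filterS _ (nbhs p) (nbhs_filter p) _ _ _ h) => r rp.
  by have [rk sr] := sP r; apply: dominates_uniq sr rp; rewrite rk pk.
apply: (@categorical_polyhedron R n K Kc _ (e \o s) q).
- move=> p; apply: (@continuous_near_eq _ _ _ (fun=> e (s p))).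
    by apply: (@filterS _ (nbhs p) (nbhs_filter p) _ _ _ (sloc p)) => r /= ->.
  exact: cst_continuous.
- move=> p; have [pk sp] := sP p; have [_ _ Kp] := polyhedronP (set_val p).
  have sps := dominates_supp sp; have Ks : K (s p) by exact: Kc sps Kp.
  apply: Kc Kp; rewrite finset.subUset subxx /=.
  apply: fintype.subset_trans sps; by apply: eP; rewrite // -card_gt0 pk.
- exact: (locally_constant_homotopy sloc).
Qed.

Lemma layer_cover (p : P) i : i \in V -> 0 < set_val p 0 i ->
  exists s : {set 'I_n}, [/\ s \subset V, K s, s != finset.set0 & dominates s p].
Proof.
move=> iV ip; pose m := [arg max_(j > i in V) set_val p 0 j]%O.
have [mV mM] : m \in V /\ forall j, j \in V -> set_val p 0 j <= set_val p 0 m.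
  by rewrite /m; case: arg_maxP.
have m0 : 0 < set_val p 0 m by apply: lt_le_trans ip (mM _ iV).
(* The vertices of [V] at which the largest coordinate over [V] is attained. *)
pose s := [set j in V | set_val p 0 j == set_val p 0 m]%SET.
have sd : dominates s p.
  split; first by apply/fintype.subsetP => j; rewrite inE => /andP[].
  move=> j; rewrite inE => /andP[jV /eqP jm]; rewrite jm; split=> // l.
  by rewrite !inE => /andP[+ lV]; rewrite lV /= => lm; rewrite lt_neqAle lm mM.
exists s; split=> //; first by case: sd.
- by have [_ _ Kp] := polyhedronP p; apply: Kc Kp; exact: dominates_supp.
- by apply/finset.set0Pn; exists m; rewrite inE mV eqxx.
Qed.

End Layers.

Lemma lscat_polyhedron (R : realType) (n : nat) (K : pred {set 'I_n})
    (X : topologicalType) (L : seq {set 'I_n}) (V : {set 'I_n}) (m : nat) :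
  complex K -> connected [set: X] -> homotopy_equiv R (polyhedron (R := R) K) X ->
  [set: X] !=set0 ->
  (forall s, s \in L -> K s && (s != finset.set0)) ->
  (forall i, (i \in V) || has (fun s : {set 'I_n} => i \in s) L) ->
  (forall s : {set 'I_n}, s \subset V -> K s -> (#|s| <= m)%N) ->
  (lscat R X <= (size L + m)%:R%:E)%E.
Proof.
move=> Kc Xc PX [x0 _] LK LV Vm; have [g [f [gc fc fg gf]]] := PX.
pose P := polyhedron (R := R) K.
(* First the stars of the members of [L], then the layers of sizes [1] to [m]; the successor skips
   size [0]. *)
pose A i : set P := if (i < size L)%N then star (nth finset.set0 L i)
                    else layer V (i - size L).+1.
have LP i : (i < size L)%N -> K (nth finset.set0 L i) && (nth finset.set0 L i != finset.set0).
  by move=> iL; apply: LK; exact: mem_nth.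
have Acov p : exists2 i, (i < size L + m)%N & A i p.
  have [_ _ Kp] := polyhedronP p.
  have /finset.set0Pn[i] := polyhedron_supp_neq0 (set_valP p).
  rewrite inE => ip; have /orP[iV|/(has_nthP finset.set0)[l lL il]] := LV i.
    have [s [sV Ks s0 sp]] := layer_cover Kc iV ip.
    have sm := Vm s sV Ks; have s1 : (0 < #|s|)%N by rewrite card_gt0.
    exists (size L + #|s|.-1)%N; first by rewrite ltn_add2l prednK.
    by rewrite /A ltnNge leq_addr /= addKn prednK //; exists s.
  exists l; first by rewrite (leq_trans lL) // leq_addr.
  by rewrite /A lL; exists i.
apply: (@lscat_le R X (size L + m) (fun i => f @^-1` A i)).
- move=> i _; have /continuousP fo := fc; apply: fo.
  by rewrite /A; case: ifP => _; [exact: star_open|exact: layer_open].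
- move=> i _; apply: (categorical_preimage fc gc gf).
  rewrite /A; case: ifP => [/LP/andP[Ks s0]|_]; first exact: star_categorical.
  apply: (@layer_categorical R n K V Kc _ (f x0)) => // p.
  exact: (polyhedron_joined Kc Xc PX).
- by move=> x; exact: Acov.
Qed.

(** * The counting argument *)

Section Greedy.
Variables (n : nat) (K : pred {set 'I_n}) (c : nat).
Hypothesis cat_le : forall (L : seq {set 'I_n}) (V : {set 'I_n}) (m : nat),
  (forall s, s \in L -> K s && (s != finset.set0)) ->
  (forall i, (i \in V) || has (fun s : {set 'I_n} => i \in s) L) ->
  (forall s : {set 'I_n}, s \subset V -> K s -> (#|s| <= m)%N) ->
  (c <= size L + m)%N.

(** Here [j] is the part of [c] not yet accounted for by [L]. If it is positive, some simplex in [V]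
    has at least [j] vertices, since otherwise [cat_le] would bound [c] by [size L + j - 1]. Its
    removal lowers [j] by one, and Pascal's rule adds up the sizes. *)
Lemma greedy_rest (j : nat) (L : seq {set 'I_n}) (V : {set 'I_n}) :
  (forall s, s \in L -> K s && (s != finset.set0)) ->
  (forall i, (i \in V) || has (fun s : {set 'I_n} => i \in s) L) ->
  (c = size L + j)%N -> ('C(j.+1, 2) <= #|V|)%N.
Proof.
elim: j L V => [//|j IH] L V LK LV cj.
have [s [sV Ks js]] : exists s : {set 'I_n}, [/\ s \subset V, K s & (j < #|s|)%N].
  apply: contrapT => h; have : (c <= size L + j)%N.
    apply: (cat_le LK LV) => s sV Ks; rewrite leqNgt; apply/negP => js.
    by apply: h; exists s.
  by rewrite cj addnS ltnn.
have sN : s != finset.set0 by rewrite -card_gt0 (leq_ltn_trans _ js).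
have : ('C(j.+1, 2) <= #|V :\: s|)%N.
  apply: (IH (s :: L)) => [t|i|]; last by rewrite cj addnS.
    by rewrite inE => /orP[/eqP ->|/LK //]; rewrite Ks.
  by rewrite /= inE; have := LV i; case: (i \in s) => /=; rewrite ?orbT.
rewrite cardsD (finset.setIidPr sV) => h.
rewrite binS bin1; have := subset_leq_card sV; lia.
Qed.

Lemma greedy_bound (s : {set 'I_n}) : K s -> s != finset.set0 ->
  (#|s| + 'C(c, 2) <= n)%N.
Proof.
move=> Ks sN; have sn : (#|s| + #|~: s| = n)%N by rewrite cardsC card_ord.
have [->|c0] := posnP c; first by rewrite bin0n; lia.
(* The first simplex, of arbitrary size, uses up one unit of [c]; the greedy removal takes place in
   its complement. *)
suff : ('C(c.-1.+1, 2) <= #|~: s|)%N by rewrite prednK //; lia.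
apply: (@greedy_rest c.-1 [:: s]).
- by move=> t; rewrite inE => /eqP ->; rewrite Ks.
- by move=> i /=; rewrite inE orbF orNb.
- by rewrite /= add1n prednK.
Qed.

End Greedy.

(** * Extended values and assembly of the inequality *)

Lemma half_bin2 (R : realType) (c : nat) :
  2^-1 * (c%:R * (c%:R - 1)) = 'C(c, 2)%:R :> R.
Proof.
elim: c => [|c IH]; first by rewrite mul0r mulr0.
by rewrite binS bin1 natrD -IH -natr1; field.
Qed.

Lemma ereal_inf_nat (R : realType) (S : set nat) : S !=set0 ->
  exists2 c, S c & ereal_inf [set n%:R%:E | n in S] = c%:R%:E :> \bar R.
Proof.
move=> [k Sk]; have h : exists k, `[< S k >] by exists k; apply/asboolP.
case: (ex_minnP h) => c /asboolP Sc cmin; exists c => //.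
apply/eqP; rewrite eq_le; apply/andP; split.
  by apply: ereal_inf_lbound; exists c.
apply/ereal_infP => _ [m Sm <-]; rewrite lee_fin ler_nat.
by apply: cmin; apply/asboolP.
Qed.

(** A finite bound excludes the value [+oo] of the empty infimum. *)
Lemma lscat_nat (R : realType) (X : topologicalType) (m : nat) :
  (lscat R X <= m%:R%:E)%E -> exists c : nat, lscat R X = c%:R%:E.
Proof.
rewrite /lscat; set S := [set n : nat | _] => Sm.
have [Sne|S0] := pselect (S !=set0).
  by have [c Sc Ec] := @ereal_inf_nat R S Sne; exists c.
have S00 : [set n%:R%:E | n in S] = set0 :> set (\bar R).
  by apply/seteqP; split=> // x [n Sn _]; apply: S0; exists n.
by move: Sm; rewrite S00 ereal_inf0 leye_eq.
Qed.

(** A complex that maps to an empty space has no cells, and the supremum of the empty set is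
    [-oo]. *)
Lemma hdim_empty (R : realType) (X : topologicalType) :
  has_CW_type R X -> ~ ([set: X] !=set0) -> hdim R X = -oo%E.
Proof.
move=> [Z ZX] X0; apply/eqP; rewrite -leeNy_eq.
apply: (@le_trans _ _ (cw_dim Z)); first by apply: ereal_inf_lbound; exists Z.
apply: ge_ereal_sup => d [i _ _]; have [f _] := ZX.
by exfalso; apply: X0; exists (f (cw_char (i := i) 0)).
Qed.

Lemma good_cover_family (R : realType) (Y : topologicalType) (U : set (set Y)) (n : nat) :
  good_cover R U -> (U #= `I_n)%card -> exists u : 'I_n -> set Y,
    [/\ forall i, open (u i), forall y, exists i, u i y &
      forall s : {set 'I_n}, s != finset.set0 -> meet_family u s !=set0 ->
        contractible_set R (meet_family u s)].
Proof.
move=> [[Uo Uc] _ Ucap]; rewrite card_eq_sym => /card_set_bijP[f [ffun _ fsurj]].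
have fim : f @` `I_n = U by apply/seteqP; split=> // _ [i ni <-]; exact: ffun.
have uU (i : 'I_n) : U (f i) by rewrite -fim; exists (i : nat) => //=.
exists (fun i : 'I_n => f i); split.
- by move=> i; exact/Uo/uU.
- move=> y; have : [set: Y] y by [].
  by rewrite -Uc -fim => -[_ [i ni <-] yi]; exists (Ordinal ni).
- move=> s /finset.set0Pn[i is_] [y ys].
  have E : meet_family (fun i : 'I_n => f i) s =
      \bigcap_(A in (fun i : 'I_n => f i) @` [set i | i \in s]) A.
    apply/seteqP; split=> [z zs _ [j js <-]|z zs j js]; first exact: zs.
    by apply: (zs (f j)); exists j.
  rewrite E; apply: Ucap.
  + by move=> _ [j _ <-].
  + by apply: finite_image; exact: finite_finset.
  + by exists (f i); exists i.
  + by exists y; rewrite -E.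
Qed.

Local Open Scope ereal_scope.

Theorem theorem2p3 (R : realType) (X : topologicalType)
  (X_connected : connected [set: X])
  (X_CW : has_CW_type R X)
  (X_good : exists U : set (set X), finite_set U /\ good_cover R U) :
  1 + hdim R X + (2^-1)%:E * (lscat R X * (lscat R X - 1)) <= ct R X.
Proof.
(* For empty [X] the homotopy dimension makes the left-hand side [-oo]. *)
have [Xne|X0] := pselect ([set: X] !=set0); last first.
  by rewrite (hdim_empty X_CW X0) addeNy addNye leNye.
have [Z ZX] := X_CW.
apply/ereal_infP => _ [Y [YX ->]]; apply/ereal_infP => _ [n [U [Ugood Un]] <-].
have [u [uo uc uctr]] := good_cover_family Ugood Un.
have [h [h' [hc h'c _ hh']]] := homotopy_equiv_trans ZX (homotopy_equiv_sym YX).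
have PX := homotopy_equiv_trans (nerve_equiv hc h'c hh' uo uc uctr) YX.
have Kc := @nerve_complex Y n u; pose K := nerve u.
have cat_le L V m := @lscat_polyhedron R n K X L V m Kc X_connected PX Xne.
(* With no simplex removed, the layers on all [n] vertices already show that the category is
   finite. *)
have [c catc] : exists c : nat, lscat R X = c%:R%:E.
  apply: (@lscat_nat R X n); apply: (cat_le [::] finset.setT n) => // [i|s _ _].
    by rewrite inE.
  by rewrite -[leqRHS]card_ord max_card.
have [x0 _] := Xne; have [_ [f _]] := PX.
have [_ _ Kp] := polyhedronP (f x0).
have pN := polyhedron_supp_neq0 (set_valP (f x0)).
(* A simplex of maximal size; the carrier of a point coming from [X] shows that there is one to
   start from. *)
pose s := [arg max_(s > supp (set_val (f x0)) | K s && (s != finset.set0)) #|s|]%N.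
have [/andP[Ks sN] smax] : K s && (s != finset.set0) /\
    forall t : {set 'I_n}, K t -> (#|t| <= #|s|)%N.
  rewrite /s; case: arg_maxnP => [|t tK tmax]; first by rewrite pN andbT; exact: Kp.
  split=> // r Kr; have [->|r0] := eqVneq r finset.set0; first by rewrite cards0.
  by apply: tmax; rewrite r0 andbT.
have s0 : (0 < #|s|)%N by rewrite card_gt0.
have hd : (hdim R X <= #|s|.-1%:R%:E)%E.
  by apply: (hdim_polyhedron Kc PX) => t /smax; rewrite prednK.
have cn : (#|s| + 'C(c, 2) <= n)%N.
  apply: (@greedy_bound n K c) => // L V m LK LV Vm.
  by have := cat_le L V m LK LV Vm; rewrite catc lee_fin ler_nat.
rewrite catc -EFinB -!EFinM half_bin2.
apply: (@le_trans _ _ (#|s|%:R%:E + 'C(c, 2)%:R%:E)%E); last first.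
  by rewrite -EFinD -natrD lee_fin ler_nat.
apply: leeD => //; rewrite -[X in (_ <= X%:R%:E)%E](prednK s0) -add1n natrD EFinD.
exact: leeD.
Qed.
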